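(* Let $S = k[X_1, \ldots, X_n]$, $\deg (X_i) = a_i > 0$, be a graded polynomial ring over a field $k$ of characteristic zero and let $M$ be a nonzero finitely generated graded $S$-module. Let $I$ be a proper homogeneous ideal of $S$ such that $\partial(I)^2 \subset I$ and $\partial (I) \subset \operatorname{ann} M$. Then $M$ is a Golod $S/I$-module.
   Context: For a homogeneous ideal $I$ of $S$ (with respect to the given grading), $\partial(I)$ denotes the ideal of $S$ generated by all partial derivatives $\frac{\partial g}{\partial X_j}$, $g\in I$, $j=1,\ldots,n$. Since $\operatorname{char} k=0$, Euler's theorem gives $I\subset\partial(I)$, so $M$ is an $S/I$-module. All modules are nonzero and finitely generated. Golod modules (graded setting): let $R=S/I$ with homogeneous maximal ideal $\mathfrak m=(X_1,\ldots,X_n)R$ and $k=R/\mathfrak m$, and let $M$ be a finitely generated graded $R$-module. Put $P^R_M(t)=\sum_{i\ge 0}\dim_k \operatorname{Tor}^R_i(k,M)\,t^i$. Let $K^R$ be the Koszul complex of $R$ on a minimal set of homogeneous generators of $\mathfrak m$, $K^M=K^R\otimes_R M$, $\kappa_R(t)=\sum_i\dim_k H_i(K^R)t^i$ and $\kappa_M(t)=\sum_i\dim_k H_i(K^M)t^i$. Then $P^R_M(t)\le \frac{\kappa_M(t)}{1-t(\kappa_R(t)-1)}$ coefficientwise, and $M$ is called a Golod $R$-module if equality holds. (This is equivalent to $M_{\mathfrak m}$ being a Golod module over the local ring $R_{\mathfrak m}$, defined by the same equality.) *)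

(* Defs.v *)
From HB Require Import structures.
From mathcomp Require Import all_boot all_order all_algebra.
From mathcomp Require Import ring_quotient.
From mathcomp Require Export mpoly.

Set Implicit Arguments.
Unset Strict Implicit.
Unset Printing Implicit Defensive.

Import GRing.Theory.

Local Open Scope ring_scope.
Local Open Scope quotient_scope.

Section Ideals.
Variable R : comNzRingType.

Definition gen_ideal (G : R -> Prop) (x : R) : Prop :=
  exists (r : nat) (c g : 'I_r -> R),
    (forall i, G (g i)) /\ x = \sum_i c i * g i.

Definition prod_ideal (A B : R -> Prop) : R -> Prop :=
  gen_ideal (fun z => exists x y, [/\ A x, B y & z = x * y]).

Definition annihilates (M : lmodType R) (x : R) : Prop :=
  forall m : M, x *: m = 0.

Definition finitely_generated (M : lmodType R) : Prop :=
  exists (r : nat) (e : 'I_r -> M),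
    forall m, exists c : 'I_r -> R, m = \sum_i c i *: e i.

Lemma gen_ideal_in (G : R -> Prop) (x : R) : G x -> gen_ideal G x.
Proof.
move=> Gx; exists 1%N, (fun=> 1), (fun=> x); split=> //.
by rewrite big_ord1 mul1r.
Qed.

End Ideals.

(* Resolutions by free modules of finite rank; vectors are rows, so that the
   differential R^(rk i.+1) -> R^(rk i) is v |-> v *m diff i. *)
Record free_resolution (R : comNzRingType) (M : lmodType R) := FreeResolution {
  rk : nat -> nat;
  diff : forall i, 'M[R]_(rk i.+1, rk i);
  aug : {linear 'rV[R]_(rk 0) -> M};
  aug_surj : forall m, exists v, aug v = m;
  exact_aug : forall v : 'rV[R]_(rk 0), aug v = 0 <-> exists w, v = w *m diff 0;
  exact_diff : forall i (v : 'rV[R]_(rk i.+1)),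
    v *m diff i = 0 <-> exists w, v = w *m diff i.+1
}.

(* The Koszul complex K(y) (x) V.  Its i-th module is the direct sum of copies
   V e_J of V, J ranging over the i-subsets of 'I_r, realized as the functions
   J |-> coefficient of e_J that vanish off the i-subsets; and
   d (v e_J) = \sum_(j in J) (-1)^#{l in J, l < j} y_j v e_(J :\ j). *)
Section Koszul.
Variables (R : comNzRingType) (r : nat) (y : 'I_r -> R) (V : lmodType R).
Implicit Types f g : {ffun {set 'I_r} -> V}.

Definition koszul_diff f : {ffun {set 'I_r} -> V} :=
  [ffun J : {set 'I_r} =>
    \sum_(j | j \notin J)
      ((-1) ^+ #|[set l in J | (l < j)%N]| * y j) *: f (j |: J)].

Definition koszul_deg (i : nat) f : Prop :=
  forall J : {set 'I_r}, #|J| != i -> f J = 0.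

Definition koszul_cycle (i : nat) f : Prop :=
  koszul_deg i f /\ koszul_diff f = 0.

Definition koszul_boundary (i : nat) f : Prop :=
  exists2 g, koszul_deg i.+1 g & f = koszul_diff g.

End Koszul.

Definition wdeg (n : nat) (a : 'I_n -> nat) (m : 'X_{1..n}) : nat :=
  (\sum_i m i * a i)%N.

Lemma wdeg0 (n : nat) (a : 'I_n -> nat) : wdeg a 0%MM = 0%N.
Proof. by rewrite /wdeg big1 // => i _; rewrite mnm0E mul0n. Qed.

Lemma wdegD (n : nat) (a : 'I_n -> nat) :
  {morph wdeg a : m1 m2 / (m1 + m2)%MM >-> (m1 + m2)%N}.
Proof.
move=> m1 m2; rewrite /wdeg -big_split /=.
by apply: eq_bigr => i _; rewrite mnmDE mulnDl.
Qed.

HB.instance Definition _ (n : nat) (a : 'I_n -> nat) :=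
  isMeasure.Build n (wdeg a) (wdeg0 a) (wdegD a).

Section Graded.
Variables (k : fieldType) (n : nat) (a : 'I_n -> nat).
Local Notation S := {mpoly k[n]}.

Definition homogeneous_ideal (I : idealr S) : Prop :=
  forall (d : nat) (p : S), p \in I -> pihomog (wdeg a) d p \in I.

(* M is the direct sum of the additive subgroups gr d, d : int, and
   S_e (gr d) is contained in gr (e + d). *)
Record is_grading (M : lmodType S) (gr : int -> M -> Prop) : Prop := IsGrading {
  grading0 : forall d, gr d 0;
  gradingB : forall d x y, gr d x -> gr d y -> gr d (x - y);
  gradingZ : forall (e : nat) d (p : S) x,
    p \is e.-homog for (wdeg a) -> gr d x -> gr (e%:Z + d) (p *: x);
  grading_span : forall x, exists (s : seq int) (z : int -> M),
    [/\ uniq s, forall d, gr d (z d) & x = \sum_(d <- s) z d];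
  grading_direct : forall (s : seq int) (z : int -> M),
    uniq s -> (forall d, gr d (z d)) -> \sum_(d <- s) z d = 0 ->
    forall d, d \in s -> z d = 0
}.

Definition deriv_ideal (I : idealr S) : S -> Prop :=
  gen_ideal (fun h => exists (g : S) (j : 'I_n), g \in I /\ h = g^`M(j)).

End Graded.

Definition quot_mod (S : comNzRingType) (I : idealr S) (M : lmodType S)
  (_ : forall s, s \in I -> annihilates M s) : Type := M.

Section QuotMod.
Variables (S : comNzRingType) (I : idealr S) (M : lmodType S).
Hypothesis h : forall s, s \in I -> annihilates M s.
Local Notation R := {ideal_quot I}.
Local Notation N := (quot_mod h).

HB.instance Definition _ := GRing.Zmodule.copy N M.

Definition quot_scale (r : R) (m : N) : N := repr r *: (m : M).

Lemma quot_scaleE (s : S) (m : N) :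
  quot_scale (\pi_R s) m = s *: (m : M) :> M.
Proof.
apply/eqP; rewrite -subr_eq0 /quot_scale -scalerBl; apply/eqP; apply: h.
by rewrite Quotient.idealrBE reprK.
Qed.

Fact quot_scaleA r1 r2 m :
  quot_scale r1 (quot_scale r2 m) = quot_scale (r1 * r2) m.
Proof.
elim/quotW: r1 => s1; elim/quotW: r2 => s2.
by rewrite -rmorphM !quot_scaleE scalerA.
Qed.

Fact quot_scale1 : left_id 1 quot_scale.
Proof. by move=> m; rewrite -(rmorph1 \pi_R) quot_scaleE scale1r. Qed.

Fact quot_scaleDr : right_distributive quot_scale +%R.
Proof. by move=> r m1 m2; rewrite /quot_scale scalerDr. Qed.

Fact quot_scaleDl m : {morph quot_scale^~ m : r1 r2 / r1 + r2}.
Proof.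
move=> r1 r2; elim/quotW: r1 => s1; elim/quotW: r2 => s2.
by rewrite -rmorphD !quot_scaleE scalerDl.
Qed.

HB.instance Definition _ := GRing.Zmodule_isLmodule.Build R N
  quot_scaleA quot_scale1 quot_scaleDr quot_scaleDl.

End QuotMod.

Section Golod.
Variables (k : fieldType) (n : nat) (a : 'I_n -> nat).
Local Notation S := {mpoly k[n]}.
Variable I : idealr S.
Local Notation R := {ideal_quot I}.

Definition max_ideal : R -> Prop :=
  gen_ideal (fun x => exists i : 'I_n, x = \pi_R ('X_i : S)).

(* The quotient Z / B of k-subspaces B <= Z of an R-module has dimension d. *)
Definition has_kdim (V : lmodType R) (Z B : V -> Prop) (d : nat) : Prop :=
  exists e : 'I_d -> V, (forall j, Z (e j)) /\
    forall z, Z z ->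
      exists! c : 'rV[k]_d, B (z - \sum_j (\pi_R ((c 0 j)%:MP : S)) *: e j).

Section Tor.
Variables (M : lmodType R) (F : free_resolution M).

(* Tor_i(k, M) is the homology of k (x) F = F / max_ideal F. *)
Definition tor_cycle (i : nat) : 'rV[R]_(rk F i) -> Prop :=
  match i with
  | 0 => fun=> True
  | j.+1 => fun v => forall l, max_ideal ((v *m diff F j) 0 l)
  end.

Definition tor_boundary (i : nat) (v : 'rV[R]_(rk F i)) : Prop :=
  exists w, forall l, max_ideal ((v - w *m diff F i) 0 l).

End Tor.

Definition poincare_series (M : lmodType R) (P : nat -> nat) : Prop :=
  exists F : free_resolution M, forall i,
    has_kdim (@tor_cycle M F i) (@tor_boundary M F i) (P i).

Definition koszul_series (r : nat) (y : 'I_r -> R) (M : lmodType R)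
    (kappa : nat -> nat) : Prop :=
  forall i, has_kdim (@koszul_cycle R r y M i) (@koszul_boundary R r y M i)
                     (kappa i).

Definition minimal_homogeneous_generators (r : nat) (y : 'I_r -> R) : Prop :=
  [/\ forall j, exists (d : nat) (p : S),
        p \is d.-homog for (wdeg a) /\ y j = \pi_R p,
      forall x, max_ideal x <-> gen_ideal (fun z => exists j, z = y j) x
    & forall J : {set 'I_r},
        (forall x, max_ideal x <->
           gen_ideal (fun z => exists2 j, j \in J & z = y j) x) ->
        J = [set: 'I_r]].

Definition series_mul (f g : nat -> int) (i : nat) : int :=
  \sum_(j < i.+1) f j * g (i - j)%N.

(* Coefficients of 1 - t (kappa(t) - 1). *)
Definition golod_denominator (kappa : nat -> nat) (i : nat) : int :=
  if i is j.+1 then - ((kappa j)%:Z - (j == 0)%:Z) else 1.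

(* The denominator has constant term 1, so it is invertible as a power series
   and P = kappa_M / denominator means P * denominator = kappa_M. *)
Definition golod_module (M : lmodType R) : Prop :=
  exists (r : nat) (y : 'I_r -> R), minimal_homogeneous_generators y /\
  exists P kappaM kappaR : nat -> nat,
    [/\ poincare_series M P,
        koszul_series y M kappaM,
        koszul_series y R^o kappaR
      & forall i, series_mul (fun j => (P j)%:Z) (golod_denominator kappaR) i
                  = (kappaM i)%:Z].

End Golod.

Section Euler.
Variables (k : fieldType) (n : nat) (a : 'I_n -> nat).
Local Notation S := {mpoly k[n]}.

Lemma euler_formula (d : nat) (p : S) : p \is d.-homog for (wdeg a) ->
  \sum_i (a i)%:R *: ('X_i * p^`M(i)) = d%:R *: p.
Proof.
move/dhomogP=> hp; rewrite [in RHS](mpolyE p) scaler_sumr.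
transitivity (\sum_i \sum_(m <- msupp p)
   (p@_m * (m i * a i)%:R) *: ('X_[m] : S)).
  apply: eq_bigr => i _; rewrite {1}(mpolyE p) linear_sum /= mulr_sumr.
  rewrite scaler_sumr; apply: eq_bigr => m _.
  rewrite mderivZ mderivX -!scalerAr !scalerA.
  case: (posnP (m i)) => [->|mi_gt0].
    by rewrite mul0n !mulr0 !scale0r.
  rewrite -mpolyXD addmC submK; last by rewrite lep1mP -lt0n.
  by congr (_ *: _); rewrite natrM mulrCA mulrA [_ * (a i)%:R]mulrC mulrA.
rewrite exchange_big /= big_seq [RHS]big_seq; apply: eq_bigr => m m_in.
rewrite -scaler_suml -mulr_sumr -natr_sum scalerA mulrC.
by rewrite -/(wdeg a m) (hp _ m_in).
Qed.

Lemma ideal_annihilates (I : idealr S) (M : lmodType S) :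
  [pchar k] =i pred0 -> (forall i, (0 < a i)%N) -> homogeneous_ideal a I ->
  (forall p, deriv_ideal I p -> annihilates M p) ->
  forall p, p \in I -> annihilates M p.
Proof.
move=> char0 a_gt0 hI hM p Ip m.
rewrite (pihomog_partitionE (leqnn (mmeasure (wdeg a) p))) scaler_suml.
apply: big1 => -[d _] _ /=; move: (hI d p Ip) (pihomogP (wdeg a) d p).
move: (pihomog _ _ p) => q; case: d => [|d] Iq hq.
  suff -> : q = 0 by rewrite scale0r.
  have qC : q = (q@_0)%:MP.
    apply/mpolyP=> m'; rewrite mcoeffC.
    case: eqVneq => [->|m'0]; first by rewrite mulr1.
    rewrite mulr0; apply: (dhomog_nemf_coeff hq).
    apply: contraNneq m'0 => /eqP; rewrite /= /wdeg sum_nat_eq0 => /forallP w0.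
    apply/eqP/mnmP => i; rewrite mnm0E; apply/eqP.
    by move: (w0 i); rewrite /= muln_eq0 [a i == 0%N]gtn_eqF ?orbF ?a_gt0 // eq_sym.
  apply/eqP; rewrite qC mpolyC_eq0; apply/negPn/negP => c0.
  have := idealMr ((q@_0)^-1)%:MP Iq.
  by rewrite {2}qC -mpolyCM mulVf // mpolyC1 idealr1.
have d0 : (d.+1)%:R != 0 :> k by rewrite ((pcharf0P k).1 char0).
have -> : q = (d.+1%:R^-1)%:MP * (d.+1%:R *: q).
  by rewrite mul_mpolyC scalerA mulVf // scale1r.
rewrite -(euler_formula hq) -scalerA scaler_suml big1 ?scaler0 // => i _.
rewrite -mul_mpolyC -!scalerA (hM q^`M(i)) ?scaler0 //.
by apply: gen_ideal_in; exists q, i.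
Qed.

End Euler.

(* Main.v *)
From HB Require Import structures.
Require Import Defs.
From mathcomp Require Import all_boot all_order all_algebra.
From mathcomp Require Import ring_quotient.
From mathcomp Require Import boolp functions.
From mathcomp Require Import zify.

(** Let [R = S / I], [y_j] the class of [X_j], [K] the Koszul complex of [y] and
    [d(I)] the derivative ideal.

    Every Koszul cycle of [R] of positive degree is homologous to one with
    coefficients in [d(I)].  Indeed the Koszul differential of [S] is contraction
    with the Euler vector field when [e_j] is read as [dX_j / a_j], so by Cartan's
    formula its anticommutator with the de Rham differential [D] multiplies each
    weight component by its weight ([cartan]).  In positive degree weights are
    positive, hence invertible in characteristic zero; dividing by them with an
    operator [N] that commutes with the Koszul differential gives
    [z = d (D N z) + D N (d z)] ([chain_homotopic_to_derivatives]).  When [z] lifts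
    a cycle of [R], [d z] has coefficients in the homogeneous ideal [I], so
    [D N (d z)] has coefficients in [d(I)].

    Choose such cycles [z_l] representing a basis of [H_i(K)], [i > 0].  Since
    [d(I)^2] lies in [I], all products [z_l z_l'] vanish at the level of chains, so
    all Massey operations of [R] can be taken to be zero, and the complex [G] of
    words [e_J (x) l_1 ... l_r], with differential
    [d(e_J) (x) l_1 ... l_r +- e_J z_(l_1) (x) l_2 ... l_r], resolves [k] over [R].
    What is needed of this is that [G (x) F] is acyclic in positive degrees for [F]
    free ([gacyclic]); the proof is an induction on the degree that splits off the
    last letter of each word.

    Let [F_*] be a free resolution of [M].  Acyclicity makes the connecting
    homomorphisms of [0 -> syzygy -> F_p -> previous syzygy -> 0] shift the
    homology of [G] by one degree ([connecting_basis]), and iterating this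
    identifies [H_i(G (x) M)] with [Tor_i(k, M)] computed from [F_*]
    ([tor_basis]).  On the other hand [d(I)] annihilates [M], so the second term
    of the differential vanishes on [G (x) M], which is a sum of shifted copies of
    [K (x) M], one for each word ([twisted_basis]).  Counting words gives
    [P_M = kappa_M / (1 - t (kappa_R - 1))] ([golod_coef_series]).

    Finite ranks come from the Hilbert basis theorem, here by Dickson's lemma
    ([mpoly_noetherian]).  The variables are minimal generators of the maximal
    ideal: if an element of [I] had a nonzero coefficient at [X_i], the derivative
    along [X_i] of its component of weight [a_i] would be a nonzero constant, so
    [d(I)] would contain 1 and kill [M] ([ideal_linear0]). *)

Set Implicit Arguments.
Unset Strict Implicit.
Unset Printing Implicit Defensive.

Import GRing.Theory.

Local Open Scope ring_scope.

(** * Submodules and bases of subquotients *)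

Section Submodules.
Variables (R : comNzRingType) (V : lmodType R).
Implicit Types (Q Z B : V -> Prop).

Definition submod Q :=
  Q 0 /\ forall (a : R) u v, Q u -> Q v -> Q (a *: u + v).

Section Closure.
Variable Q : V -> Prop.
Hypothesis sQ : submod Q.

Lemma submod0 : Q 0. Proof. by case: sQ. Qed.

Lemma submodZ (a : R) u : Q u -> Q (a *: u).
Proof. by move=> Qu; rewrite -[_ *: _]addr0; apply: sQ.2 => //; apply: submod0. Qed.

Lemma submodD u v : Q u -> Q v -> Q (u + v).
Proof. by move=> Qu Qv; rewrite -[u]scale1r; apply: sQ.2. Qed.

Lemma submodN u : Q u -> Q (- u).
Proof. by rewrite -scaleN1r; apply: submodZ. Qed.

Lemma submodB u v : Q u -> Q v -> Q (u - v).
Proof. by move=> Qu /submodN; apply: submodD. Qed.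

Lemma submod_sum (I : Type) (r : seq I) (P : pred I) (F : I -> V) :
  (forall i, P i -> Q (F i)) -> Q (\sum_(i <- r | P i) F i).
Proof. by move=> QF; elim/big_ind: _ => //; [apply: submod0 | apply: submodD]. Qed.

End Closure.

End Submodules.

Section QuotientBases.
Variables (k : fieldType) (R : comNzRingType) (iota : {rmorphism k -> R}).

(** Homology is only ever used through its dimension, so a subquotient [Z / B] is
    kept as a pair of predicates together with representatives of a basis. *)
Definition quot_basis (V : lmodType R) (Z B : V -> Prop) (T : finType)
    (e : T -> V) :=
  [/\ forall t, Z (e t),
      forall z, Z z -> exists c : T -> k, B (z - \sum_t iota (c t) *: e t)
    & forall c : T -> k, B (\sum_t iota (c t) *: e t) -> forall t, c t = 0].

Definition has_quot_basis (V : lmodType R) (Z B : V -> Prop) (T : finType) :=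
  exists e : T -> V, quot_basis Z B e.

Lemma quot_basis_iff (V : lmodType R) (Z B Z' B' : V -> Prop) (T : finType) :
  (forall z, Z z <-> Z' z) -> (forall z, B z <-> B' z) ->
  has_quot_basis Z B T -> has_quot_basis Z' B' T.
Proof.
move=> ZZ BB [e [eZ sp ind]]; exists e; split.
- by move=> t; apply/ZZ.
- by move=> z /ZZ /sp [c]; exists c; apply/BB.
- by move=> c /BB; apply: ind.
Qed.

(** A linear correspondence between two subquotients that induces an isomorphism
    carries bases to bases; the connecting maps of homological algebra are of
    this kind. *)
Lemma quot_basis_transfer (V W : lmodType R) (Z B : V -> Prop)
    (Z' B' : W -> Prop) (rho : V -> W -> Prop) (T : finType) :
  rho 0 0 ->
  (forall a z1 z2 x1 x2, rho z1 x1 -> rho z2 x2 ->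
     rho (a *: z1 + z2) (a *: x1 + x2)) ->
  (forall z, Z z -> exists2 x, Z' x & rho z x) ->
  (forall x, Z' x -> exists2 z, Z z & rho z x) ->
  (forall z x, rho z x -> B z <-> B' x) ->
  has_quot_basis Z B T -> has_quot_basis Z' B' T.
Proof.
move=> r0 rD Zr Zr' rB [e [eZ sp ind]].
have /boolp.choice [e' he'] : forall t, exists x, Z' x /\ rho (e t) x.
  by move=> t; have [x] := Zr _ (eZ t); exists x.
have rS (c : T -> k) :
    rho (\sum_t iota (c t) *: e t) (\sum_t iota (c t) *: e' t).
  elim/big_ind2: _ => // [z1 x1 z2 x2 r1 r2|t _].
    by have := rD 1 _ _ _ _ r1 r2; rewrite !scale1r.
  by have := rD (iota (c t)) _ _ _ _ (he' t).2 r0; rewrite !addr0.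
exists e'; split=> [t|x /Zr' [z /sp [c Bz] rzx]|c /(rB _ _ (rS c))].
- exact: (he' t).1.
- exists c; have := rD (-1) _ _ _ _ (rS c) rzx.
  by rewrite !scaleN1r addrC [X in rho _ X]addrC => /rB <-.
- exact: ind.
Qed.

(** A nontrivial relation lets one member of the family be eliminated; the
    induction on [r] stops at an independent family. *)
Lemma quot_basis_exists (V : lmodType R) (Z B : V -> Prop) (r : nat)
    (e : 'I_r -> V) :
  submod B -> (forall i, Z (e i)) ->
  (forall z, Z z -> exists c : 'I_r -> k, B (z - \sum_i iota (c i) *: e i)) ->
  exists d, has_quot_basis Z B 'I_d.
Proof.
move=> sB; elim: r e => [|r IH] e eZ sp.
  by exists 0%N, e; split=> // c _ [].
have [ind|/existsNP [c]] := pselect (forall c : 'I_r.+1 -> k,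
    B (\sum_t iota (c t) *: e t) -> forall t, c t = 0).
  by exists r.+1, e.
move=> /not_implyP [Bc /existsNP [j /eqP cj]].
apply: (IH (fun i => e (lift j i))) => [i|z /sp [b Bb]]; first exact: eZ.
exists (fun i => b (lift j i) - b j / c j * c (lift j i)).
have Bcj := submodZ sB (iota (b j / c j)) Bc.
have := submodD sB Bb Bcj; congr B.
rewrite (bigD1_ord j) //= [in X in _ + X](bigD1_ord j) //= opprD addrA.
rewrite scalerDr scalerA -rmorphM divfK // addrACA -!addrA; congr (_ + _).
rewrite addrA addNr add0r scaler_sumr -!sumrN -big_split /=.
apply: eq_bigr => i _.
by rewrite rmorphB scalerBl opprB scalerA -rmorphM addrC.
Qed.

Lemma has_quot_basis_card (V : lmodType R) (Z B : V -> Prop) (T : finType) :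
  has_quot_basis Z B T -> has_quot_basis Z B 'I_#|T|.
Proof.
move=> [e [eZ sp ind]]; pose h : 'I_#|T| -> T := @enum_val T T; exists (e \o h).
have S (c : T -> k) : \sum_i iota (c (h i)) *: (e \o h) i = \sum_t iota (c t) *: e t.
  transitivity (\sum_(t in T) iota (c t) *: e t); last exact: eq_bigl.
  by rewrite [RHS]big_enum_val.
split=> [i|z /sp [c Bc]|c Bc i]; first exact: eZ.
  by exists (c \o h); rewrite S.
rewrite -(enum_valK i); apply: (ind (c \o enum_rank)).
by rewrite -S /=; under eq_bigr => j _ do rewrite enum_valK.
Qed.

(** Used to choose representatives with coefficients in a prescribed ideal. *)
Lemma quot_basis_adjust (V : lmodType R) (Z B P : V -> Prop) (T : finType) :
  submod B -> (forall z, Z z -> exists x, [/\ P x, Z x & B (z - x)]) ->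
  has_quot_basis Z B T ->
  exists2 e : T -> V, quot_basis Z B e & forall t, P (e t).
Proof.
move=> sB ZP [e [eZ sp ind]].
have /boolp.choice [e' he'] := fun t => ZP _ (eZ t).
exists e' => [|t]; last by have [] := he' t.
have ee' (c : T -> k) : B (\sum_t iota (c t) *: e t - \sum_t iota (c t) *: e' t).
  rewrite -sumrB; apply: submod_sum => // t _; rewrite -scalerBr.
  by apply: submodZ => //; have [] := he' t.
split=> [t|z /sp [c Bc]|c Bc]; first by have [] := he' t.
  by exists c; have := submodD sB Bc (ee' c); rewrite addrA subrK.
by apply: ind; have := submodD sB (ee' c) Bc; rewrite subrK.
Qed.

End QuotientBases.

(** * Exterior and interior multiplication on Koszul chains *)

Section SignedSubsets.
Variables (n : nat).
Implicit Types (i j : 'I_n) (J : {set 'I_n}).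

Definition preds J j := #|[set l in J | (l < j)%N]|.

Lemma preds_setU1 i J j : i \notin J ->
  preds (i |: J) j = ((i < j) + preds J j)%N.
Proof.
move=> iJ; rewrite /preds; have [ij|ij] := boolP (i < j)%N.
  have -> : [set l in i |: J | (l < j)%N] = i |: [set l in J | (l < j)%N].
    apply/setP=> l; rewrite !inE; case: (eqVneq l i) => [->|]; rewrite ?ij //.
  by rewrite cardsU1 !inE (negPf iJ).
rewrite add0n; apply: eq_card => l; rewrite !inE; case: (eqVneq l _) => [->|//].
by rewrite (negPf ij) !andbF.
Qed.

Lemma preds_setU1_id j J : preds (j |: J) j = preds J j.
Proof.
apply: eq_card => l; rewrite !inE; case: (eqVneq l _) => [->|//].
by rewrite ltnn !andbF.
Qed.

Lemma preds_setD1_id j J : preds (J :\ j) j = preds J j.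
Proof.
apply: eq_card => l; rewrite !inE; case: (eqVneq l _) => [->|//].
by rewrite ltnn !andbF.
Qed.

End SignedSubsets.

Section KoszulOperators.
Variables (R : comNzRingType) (n : nat) (y : 'I_n -> R).

Section OneModule.
Variable V : lmodType R.
Implicit Types (f g : {ffun {set 'I_n} -> V}) (J : {set 'I_n}).

Definition wedge j f : {ffun {set 'I_n} -> V} :=
  [ffun J : {set 'I_n} =>
     if j \in J then (-1) ^+ preds J j *: f (J :\ j) else 0].

Definition contract j f : {ffun {set 'I_n} -> V} :=
  [ffun J : {set 'I_n} =>
     if j \in J then 0 else (-1) ^+ preds J j *: f (j |: J)].

Lemma koszul_diffE f : koszul_diff y f = \sum_j y j *: contract j f.
Proof.
apply/ffunP=> J; rewrite !ffunE sum_ffunE big_mkcond /=.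
apply: eq_bigr => j _; rewrite !ffunE; case: (j \in J) => /=; first by rewrite scaler0.
by rewrite scalerA mulrC.
Qed.

Lemma wedge_is_linear j : linear (wedge j).
Proof.
move=> a f g; apply/ffunP=> J; rewrite !ffunE; case: ifP => _.
  by rewrite scalerDr !scalerA mulrC.
by rewrite scaler0 addr0.
Qed.
HB.instance Definition _ j := GRing.isLinear.Build R
  {ffun {set 'I_n} -> V} {ffun {set 'I_n} -> V} _ (wedge j) (wedge_is_linear j).

Lemma contract_is_linear j : linear (contract j).
Proof.
move=> a f g; apply/ffunP=> J; rewrite !ffunE; case: ifP => _.
  by rewrite scaler0 addr0.
by rewrite scalerDr !scalerA mulrC.
Qed.
HB.instance Definition _ j := GRing.isLinear.Build R
  {ffun {set 'I_n} -> V} {ffun {set 'I_n} -> V} _ (contract j)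
  (contract_is_linear j).

Lemma koszul_diff_is_linear : linear (@koszul_diff R n y V).
Proof.
move=> a f g; rewrite !koszul_diffE scaler_sumr -big_split; apply: eq_bigr => j _.
by rewrite linearP scalerDr !scalerA mulrC.
Qed.
HB.instance Definition _ := GRing.isLinear.Build R
  {ffun {set 'I_n} -> V} {ffun {set 'I_n} -> V} _ (@koszul_diff R n y V)
  koszul_diff_is_linear.

(** The Clifford relation; all sign computations with subsets are confined here. *)
Lemma contract_wedge i j f :
  contract i (wedge j f) + wedge j (contract i f) = if i == j then f else 0.
Proof.
apply/ffunP=> J; rewrite !ffunE; case: (eqVneq i j) => [->|ij].
  have [jJ|jJ] := boolP (j \in J).
    rewrite ?ffunE !inE eqxx /= preds_setD1_id scalerA -expr2 sqrr_sign.
    by rewrite scale1r setD1K // add0r.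
  by rewrite ?ffunE !inE eqxx /= preds_setU1_id scalerA -expr2 sqrr_sign
    scale1r setU1K // addr0.
rewrite ?ffunE; have [iJ|iJ] := boolP (i \in J).
  by case: ifP => jJ; rewrite ?ffunE ?inE ?iJ ?ij ?scaler0 ?addr0.
rewrite ?ffunE !inE eq_sym (negPf ij) /=; case: ifP => jJ; last first.
  by rewrite scaler0 addr0.
rewrite (negPf iJ).
have -> : (i |: J) :\ j = i |: (J :\ j).
  apply/setP=> l; rewrite !inE; case: (eqVneq l i) => [->|]; last by [].
  by rewrite ij.
rewrite !scalerA -!exprD -scalerDl preds_setU1 //.
have {1}-> : preds J i = ((j < i) + preds (J :\ j) i)%N.
  by rewrite -preds_setU1 ?setD1K // !inE eqxx.
have ji1 : ((i < j) + (j < i) = 1)%N.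
  by move: ij; rewrite -val_eqE /= neq_ltn; case: ltngtP.
have -> : ((j < i) + preds (J :\ j) i + ((i < j) + preds J j))%N =
   (preds J j + preds (J :\ j) i).+1.
  by rewrite addnACA [((j < i) + _)%N]addnC ji1 add1n [(preds J j + _)%N]addnC.
by rewrite exprS mulN1r addNr scale0r.
Qed.

(** This homotopy is why [y j] acts as zero on Koszul homology. *)
Lemma koszul_diff_wedge j f :
  koszul_diff y (wedge j f) = y j *: f - wedge j (koszul_diff y f).
Proof.
apply/eqP; rewrite eq_sym subr_eq; apply/eqP.
rewrite !koszul_diffE linear_sum -big_split /= (bigD1 j) //= big1 ?addr0.
  by rewrite linearZ -scalerDr contract_wedge eqxx.
by move=> i ij; rewrite linearZ -scalerDr contract_wedge (negPf ij) scaler0.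
Qed.

Lemma koszul_deg_wedge i j f : koszul_deg i f -> koszul_deg i.+1 (wedge j f).
Proof.
move=> df J; rewrite ffunE; case: ifP => // jJ.
by rewrite (cardsD1 j) jJ add1n eqSS => /df->; rewrite scaler0.
Qed.

Lemma koszul_deg_diff i f : koszul_deg i.+1 f -> koszul_deg i (koszul_diff y f).
Proof.
move=> df J Ji; rewrite ffunE big1 // => j jJ; rewrite df ?scaler0 //.
by rewrite cardsU1 jJ.
Qed.

Lemma koszul_deg_lin i (a : R) f g :
  koszul_deg i f -> koszul_deg i g -> koszul_deg i (a *: f + g).
Proof. by move=> df dg J Ji; rewrite !ffunE df // dg // scaler0 addr0. Qed.

(** Left multiplication by [e_J]; the fold keeps the factors in increasing order. *)
Definition wedges J f :=
  foldr (fun j g => if j \in J then wedge j g else g) f (enum 'I_n).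

Lemma wedges0 f : wedges set0 f = f.
Proof. by rewrite /wedges; elim: (enum _) => //= j s ->; rewrite inE. Qed.

Lemma wedges_coef (P : V -> Prop) f J :
  P 0 -> (forall x, P x -> P (- x)) -> (forall A, P (f A)) ->
  forall A, P (wedges J f A).
Proof.
move=> P0 PN Pf; rewrite /wedges; elim: (enum _) => //= j s IH A.
case: ifP => // _; rewrite ffunE; case: ifP => // _.
rewrite -signr_odd; case: odd; rewrite ?expr0 ?expr1 ?scale1r ?scaleN1r //.
exact: PN.
Qed.

Lemma koszul_deg_wedges d f J :
  koszul_deg d f -> koszul_deg (#|J| + d) (wedges J f).
Proof.
move=> df; rewrite /wedges cardE.
have -> : enum J = [seq j <- enum 'I_n | j \in J] by rewrite enumT.
elim: (enum 'I_n) => //= j s IH; case: (j \in J) => //=.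
exact: koszul_deg_wedge.
Qed.

(** Iterating [koszul_diff_wedge] along the increasing enumeration of [J]: the
    sign of the term [j] counts the factors [e_l], [l < j], that stand before
    [e_j]. *)
Lemma koszul_diff_wedges f J : koszul_diff y f = 0 ->
  koszul_diff y (wedges J f) =
  \sum_(j in J) ((-1) ^+ preds J j * y j) *: wedges (J :\ j) f.
Proof.
(* The induction runs over a suffix [s] of the enumeration of 'I_n, with the sign
   counting the elements of [J] in [s] only. *)
move=> df0; rewrite /wedges /preds.
have E : [/\ uniq (enum 'I_n), sorted ltn (map val (enum 'I_n)) &
   forall l : 'I_n, l \in enum 'I_n].
  by rewrite enum_uniq val_enum_ord iota_ltn_sorted; split=> // l; rewrite mem_enum.
have {E} [us ss mem_s] := E.
suff H : koszul_diff y (foldr (fun j g => if j \in J then wedge j g else g) f (enum 'I_n))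
  = \sum_(j <- enum 'I_n | j \in J)
     ((-1) ^+ count (fun l : 'I_n => (l \in J) && (l < j)%N) (enum 'I_n) * y j) *:
      foldr (fun i g => if i \in J :\ j then wedge i g else g) f (enum 'I_n).
  rewrite H big_enum_cond /=; apply: eq_bigr => j jJ.
  congr ((_ ^+ _ * _) *: _); rewrite -size_filter cardE enumT; congr size.
  by apply: eq_filter => l; rewrite !inE.
move: (enum _) us ss {mem_s} => s; elim: s => [|j s IH] /=.
  by rewrite big_nil.
move=> /andP[js us] ss.
have lt_s l : l \in s -> (j < l)%N.
  move=> ls; move: ss; rewrite path_sortedE; last exact: ltn_trans.
  by move=> /andP[/allP/(_ _ (map_f val ls))].
have cj0 : count (fun l : 'I_n => (l \in J) && (l < j)%N) s = 0%N.
  apply/eqP; rewrite -leqn0 leqNgt -has_count; apply/hasPn => l /lt_s jl.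
  by rewrite negb_and ltnNge (ltnW jl) orbT.
have foldj : foldr (fun i g => if i \in J :\ j then wedge i g else g) f s
    = foldr (fun i g => if i \in J then wedge i g else g) f s.
  elim: s js {IH us ss lt_s cj0} => //= l s IH; rewrite inE negb_or eq_sym.
  by move=> /andP[lj js]; rewrite IH // !inE lj.
have {}IH := IH us (path_sorted ss).
have cS l : l \in s -> count (fun i : 'I_n => (i \in J) && (i < l)%N) (j :: s) =
    ((j \in J) + count (fun i : 'I_n => (i \in J) && (i < l)%N) s)%N.
  by move=> /lt_s jl; rewrite /= jl andbT.
rewrite big_cons; have [jJ|jJ] := boolP (j \in J).
  rewrite koszul_diff_wedge IH ltnn andbF cj0 expr0 mul1r !inE eqxx /= foldj.
  congr (_ + _); rewrite linear_sum -sumrN big_seq_cond [RHS]big_seq_cond.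
  apply: eq_bigr => l /andP[ls lJ]; rewrite (lt_s _ ls) !inE jJ andbT /=.
  have -> : j != l by apply: contraNneq js => ->.
  by rewrite linearZ add1n exprS mulN1r mulNr scaleNr.
rewrite IH big_seq_cond [RHS]big_seq_cond.
by apply: eq_bigr => l /andP[ls lJ]; rewrite !inE (negPf jJ) andbF.
Qed.

Definition unit_chain (u : V) : {ffun {set 'I_n} -> V} :=
  [ffun J : {set 'I_n} => if J == set0 then u else 0].

Lemma unit_chain_is_linear : linear unit_chain.
Proof.
by move=> a u v; apply/ffunP=> J; rewrite !ffunE; case: ifP; rewrite ?scaler0 ?addr0.
Qed.
HB.instance Definition _ := GRing.isLinear.Build R
  V {ffun {set 'I_n} -> V} _ unit_chain unit_chain_is_linear.

Lemma unit_chain_deg u : koszul_deg 0 (unit_chain u).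
Proof. by move=> J; rewrite ffunE cards_eq0 => /negPf->. Qed.

Lemma koszul_deg0E f : koszul_deg 0 f -> f = unit_chain (f set0).
Proof.
move=> df; apply/ffunP=> J; rewrite ffunE; case: eqVneq => [->//|J0].
by apply: df; rewrite cards_eq0.
Qed.

Lemma koszul_deg0_diff f : koszul_deg 0 f -> koszul_diff y f = 0.
Proof.
move=> df; apply/ffunP=> J; rewrite !ffunE big1 // => j jJ.
by rewrite df ?scaler0 // cardsU1 jJ.
Qed.

(** [d \o d] commutes with every [wedge j] and vanishes in degree 0; the identity
    [f = e_j (i_j f) + i_j (e_j f)] then removes [j] from the support of [f]. *)
Lemma koszul_diff_diff f : koszul_diff y (koszul_diff y f) = 0.
Proof.
suff H (s : seq 'I_n) g : (forall J, ~~ (J \subset s) -> g J = 0) ->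
    koszul_diff y (koszul_diff y g) = 0.
  apply: (H (enum 'I_n)) => J /negP[]; apply/subsetP=> l _.
  by rewrite mem_enum.
elim: s g => [|j s IH] g sg.
  rewrite [koszul_diff y g]koszul_deg0_diff ?linear0 // => J.
  rewrite cards_eq0 => J0; apply: sg; apply: contraNN J0 => /subsetP J0.
  by rewrite -subset0; apply/subsetP=> l /J0.
have -> : g = wedge j (contract j g) + contract j (wedge j g).
  by rewrite addrC contract_wedge eqxx.
have sub_s (J : {set 'I_n}) : J \subset j :: s -> j \notin J -> J \subset s.
  move=> /subsetP Js jJ; apply/subsetP=> l lJ; move: (Js l lJ).
  by rewrite inE; case: eqVneq => // lj _; rewrite -lj lJ in jJ.
rewrite linearD /= linearD /= [X in _ + X]IH ?addr0 => [|J Js]; last first.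
  rewrite !ffunE; have [//|jJ] := boolP (j \in J).
  rewrite setU11 setU1K // sg ?scaler0 // ; apply: contraNN Js => Js.
  exact: sub_s.
rewrite koszul_diff_wedge linearB /= linearZ /= koszul_diff_wedge opprB addrC.
rewrite subrK IH ?linear0 // => J Js; rewrite ffunE.
have [//|jJ] := boolP (j \in J); rewrite sg ?scaler0 //.
apply: contraNN Js => Js; apply: sub_s => //.
by apply: subset_trans Js; apply: subsetUr.
Qed.

End OneModule.
End KoszulOperators.

(** * Right multiplication by a Koszul chain *)

Definition map_chain (R : comNzRingType) (n : nat) (V W : lmodType R)
    (phi : V -> W) (f : {ffun {set 'I_n} -> V}) : {ffun {set 'I_n} -> W} :=
  [ffun J => phi (f J)].

Section MapChain.
Variables (R : comNzRingType) (n : nat) (V W : lmodType R) (phi : {linear V -> W}).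

Lemma map_chain_is_linear : linear (@map_chain R n V W phi).
Proof. by move=> a f g; apply/ffunP=> J; rewrite !ffunE linearP. Qed.
HB.instance Definition _ := GRing.isLinear.Build R
  {ffun {set 'I_n} -> V} {ffun {set 'I_n} -> W} _ (@map_chain R n V W phi)
  map_chain_is_linear.

Lemma map_chain_unit u : map_chain phi (unit_chain n u) = unit_chain n (phi u).
Proof. by apply/ffunP=> J; rewrite !ffunE; case: ifP => // _; rewrite linear0. Qed.

Lemma koszul_deg_map i (f : {ffun {set 'I_n} -> V}) :
  koszul_deg i f -> koszul_deg i (map_chain phi f).
Proof. by move=> df J Ji; rewrite ffunE df ?linear0. Qed.

End MapChain.

Section Multiplication.
Variables (R : comNzRingType) (n : nat) (y : 'I_n -> R).
Implicit Types z : {ffun {set 'I_n} -> R^o}.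

(** Right multiplication by [z], twisted by the parity of the degree so that it
    anticommutes with the differential when [z] is a cycle. *)
Definition mulr_chain (V : lmodType R) z (f : {ffun {set 'I_n} -> V}) :
    {ffun {set 'I_n} -> V} :=
  [ffun A : {set 'I_n} =>
     \sum_(J : {set 'I_n}) ((-1) ^+ #|J| * (wedges J z A : R)) *: f J].

Lemma mulr_chain_is_linear (V : lmodType R) z : linear (@mulr_chain V z).
Proof.
move=> a f g; apply/ffunP=> A; rewrite !ffunE scaler_sumr -big_split /=.
by apply: eq_bigr => J _; rewrite !ffunE scalerDr !scalerA [a * _]mulrC.
Qed.
HB.instance Definition _ (V : lmodType R) z := GRing.isLinear.Build R
  {ffun {set 'I_n} -> V} {ffun {set 'I_n} -> V} _ (@mulr_chain V z)
  (@mulr_chain_is_linear V z).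

Lemma mulr_chain_deg (V : lmodType R) z (f : {ffun {set 'I_n} -> V}) d i :
  koszul_deg d z -> koszul_deg i f -> koszul_deg (d + i) (mulr_chain z f).
Proof.
move=> dz df A Ai; rewrite ffunE big1 // => J _.
have [Ji|Ji] := eqVneq #|J| i; last by rewrite df ?scaler0.
by rewrite (koszul_deg_wedges (J := J) dz) ?mulr0 ?scale0r // Ji addnC.
Qed.

(** Being left-linear over the exterior algebra, right multiplication by a cycle
    commutes with the differential; the twist by parity adds the minus sign. *)
Lemma mulr_chain_diff (V : lmodType R) z (f : {ffun {set 'I_n} -> V}) :
  koszul_diff y z = 0 ->
  koszul_diff y (mulr_chain z f) = - mulr_chain z (koszul_diff y f).
Proof.
move=> dz; apply/ffunP=> A; rewrite !ffunE.
transitivity (\sum_(J : {set 'I_n})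
    ((-1) ^+ #|J| * (koszul_diff y (wedges J z) A : R)) *: f J).
  under eq_bigr => j _ do rewrite ffunE scaler_sumr.
  rewrite exchange_big /=; apply: eq_bigr => J _.
  rewrite ffunE mulr_sumr scaler_suml; apply: eq_bigr => j _.
  by rewrite scalerA; congr (_ *: _); apply: mulrCA.
under eq_bigr => J _.
  rewrite koszul_diff_wedges // sum_ffunE mulr_sumr scaler_suml.
  under eq_bigr => j _ do rewrite ffunE.
  over.
rewrite (exchange_big_dep predT) //=.
rewrite -sumrN; under [RHS]eq_bigr => J _ do rewrite ffunE scaler_sumr -sumrN.
rewrite [RHS](exchange_big_dep predT) //=; apply: eq_bigr => j _.
rewrite (reindex_onto (fun J : {set 'I_n} => j |: J) (fun J => J :\ j)) /=; last first.
  by move=> J jJ; rewrite setD1K.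
apply: eq_big => [J|J /andP[_ /eqP jJ]].
  rewrite setU11 /=; apply/eqP/idP => [<-|jJ]; first by rewrite !inE eqxx.
  by rewrite setU1K.
have jnJ : j \notin J by rewrite -jJ !inE eqxx.
rewrite setU1K // cardsU1 jnJ exprS mulN1r mulNr scaleNr scalerA.
congr (- (_ *: _)); rewrite /preds -/(preds (j |: J) j) preds_setU1_id /preds.
by rewrite -[RHS]mulrA; congr (_ * _); apply: mulrC.
Qed.

Lemma mulr_chain_map (V W : lmodType R) (phi : {linear V -> W}) z
    (f : {ffun {set 'I_n} -> V}) :
  mulr_chain z (map_chain phi f) = map_chain phi (mulr_chain z f).
Proof.
apply/ffunP=> A; rewrite !ffunE linear_sum; apply: eq_bigr => J _.
by rewrite !ffunE linearZ.
Qed.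

Lemma koszul_diff_map (V W : lmodType R) (phi : {linear V -> W})
    (f : {ffun {set 'I_n} -> V}) :
  koszul_diff y (map_chain phi f) = map_chain phi (koszul_diff y f).
Proof.
apply/ffunP=> A; rewrite !ffunE linear_sum; apply: eq_bigr => J _.
by rewrite !ffunE linearZ.
Qed.


Lemma mulr_chain0 (V : lmodType R) z (f : {ffun {set 'I_n} -> V}) :
  (forall A J, z A *: f J = 0) -> mulr_chain z f = 0.
Proof.
move=> zf; apply/ffunP=> A; rewrite !ffunE big1 // => J _.
rewrite -scalerA (_ : (wedges J z A : R) *: f J = 0) ?scaler0 //.
move: A; apply: (@wedges_coef R n R^o (fun t => (t : R) *: f J = 0)) => //.
- by rewrite scale0r.
- by move=> t tx; rewrite scaleNr tx oppr0.
Qed.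

(** Every coefficient of the composite is a multiple of some [z A * z' B]. *)
Lemma mulr_chain_mulr_chain (V : lmodType R) z z' (f : {ffun {set 'I_n} -> V}) :
  (forall A B, (z A : R) * z' B = 0) -> mulr_chain z (mulr_chain z' f) = 0.
Proof.
move=> zz; apply: mulr_chain0 => A J; rewrite ffunE scaler_sumr big1 // => B _.
rewrite scalerA mulrCA (_ : z A * wedges B z' J = 0 :> R) ?mulr0 ?scale0r //.
move: J; apply: (@wedges_coef R n R^o (fun t => z A * (t : R) = 0 :> R)) => //.
- by rewrite mulr0.
- by move=> t tx; rewrite mulrN tx oppr0.
Qed.

Lemma mulr_unit_chain (V : lmodType R) z (u : V) A :
  mulr_chain z (unit_chain n u) A = (z A : R) *: u.
Proof.
rewrite ffunE (bigD1 set0) //= big1 ?addr0 => [|J J0].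
  by rewrite cards0 expr0 mul1r wedges0 ffunE eqxx.
by rewrite ffunE (negPf J0) scaler0.
Qed.

End Multiplication.

(** * The twisted complex and its acyclicity *)

Section TwistedComplex.
Variables (R : comNzRingType) (n : nat) (y : 'I_n -> R).
Variables (L : finType) (deg : L -> nat) (z : L -> {ffun {set 'I_n} -> R^o}).
Hypothesis deg_gt0 : forall l, (0 < deg l)%N.
Hypothesis z_deg : forall l, koszul_deg (deg l) (z l).
Hypothesis z_cycle : forall l, koszul_diff y (z l) = 0.
Hypothesis z_mul : forall l l' A B, (z l A : R) * z l' B = 0.

Local Notation "'K[' V ]" := {ffun {set 'I_n} -> V} (format "'K[' V ]").
Local Notation "'G[' V ]" := (seq L -> {ffun {set 'I_n} -> V})
  (format "'G[' V ]").

(** A letter [l] stands for the cycle [z l] shifted by one degree, as in the bar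
    construction. *)
Definition wt (w : seq L) := (\sum_(l <- w) (deg l).+1)%N.

Lemma wt_nil : wt [::] = 0%N. Proof. exact: big_nil. Qed.
Lemma wt_cons l w : wt (l :: w) = ((deg l).+1 + wt w)%N.
Proof. exact: big_cons. Qed.
Lemma wt_rcons l w : wt (rcons w l) = (wt w + (deg l).+1)%N.
Proof. by rewrite /wt -cats1 big_cat big_seq1. Qed.

Section OneModule.
Variable V : lmodType R.
Implicit Types f g : G[V].

(** The chain [f] is the sum of the [f w (x) w]; the differential lets the first
    letter of a word act on its coefficient. *)
Definition gdiff f : G[V] :=
  fun w => koszul_diff y (f w) + \sum_l mulr_chain (z l) (f (l :: w)).

Lemma gdiff_is_linear : linear gdiff.
Proof.
move=> a f g; apply/funext => w.
rewrite /gdiff [(_ + _) w]/= -[LHS]/(koszul_diff y (a *: f w + g w) +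
  \sum_l mulr_chain (z l) (a *: f (l :: w) + g (l :: w))).
rewrite -[RHS]/(a *: gdiff f w + gdiff g w) /gdiff linearP scalerDr addrACA.
congr (_ + _); rewrite scaler_sumr -big_split /=.
by apply: eq_bigr => l _; rewrite linearP.
Qed.
HB.instance Definition _ := GRing.isLinear.Build R (G[V]) (G[V]) _ gdiff
  gdiff_is_linear.

Lemma gdiff_gdiff f : gdiff (gdiff f) = 0.
Proof.
apply/funext => w; rewrite /gdiff linearD /= koszul_diff_diff add0r linear_sum.
rewrite -big_split big1 //= => l _; rewrite mulr_chain_diff // linearD /= addrA.
rewrite addNr add0r linear_sum big1 // => l' _.
by rewrite /= mulr_chain_mulr_chain.
Qed.

Definition gdeg i f := forall w (J : {set 'I_n}), (wt w + #|J|)%N != i -> f w J = 0.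

Lemma gdeg_lin i a f g : gdeg i f -> gdeg i g -> gdeg i (a *: f + g).
Proof.
move=> df dg w J Ji; rewrite -[LHS]/((a *: f w + g w) J) !ffunE df // dg //.
by rewrite scaler0 addr0.
Qed.

Lemma gdegD i f g : gdeg i f -> gdeg i g -> gdeg i (f + g).
Proof. by rewrite -[f in f + g]scale1r; apply: gdeg_lin. Qed.

Lemma gdegN i f : gdeg i f -> gdeg i (- f).
Proof. by move=> df w J Ji; rewrite ffunE df ?oppr0. Qed.

Lemma gdeg_koszul i f w : gdeg i f -> (wt w <= i)%N ->
  koszul_deg (i - wt w) (f w).
Proof. by move=> df wi J Ji; apply: df; lia. Qed.

Lemma gdeg_eq0 i f w : gdeg i f -> (i < wt w)%N -> f w = 0.
Proof. by move=> df wi; apply/ffunP=> J; rewrite ffunE df //; lia. Qed.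

Lemma gdiff_deg i f : gdeg i.+1 f -> gdeg i (gdiff f).
Proof.
move=> df w J Ji; rewrite /gdiff ffunE [X in X + _]ffunE big1 ?add0r; last first.
  by move=> j jJ; rewrite df ?scaler0 // cardsU1 jJ; lia.
rewrite sum_ffunE big1 // => l _.
have [wi|wi] := leqP (wt (l :: w)) i.+1; last first.
  by rewrite (gdeg_eq0 df) // linear0 ffunE.
apply: (mulr_chain_deg (@z_deg l) (gdeg_koszul df wi)).
by move: wi; rewrite wt_cons; lia.
Qed.

(** Together with [koszul_independent] this says that
    [H_i(K (x) V)] is the sum of the [V / yV] indexed by the letters of degree [i].
    Coefficients are taken in [V] and not in [k] so that both properties pass from
    [R] to free modules coordinatewise. *)
Definition koszul_spanned := forall i (f : K[V]), (0 < i)%N ->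
  koszul_deg i f -> koszul_diff y f = 0 ->
  exists (g : K[V]) (u : L -> V), koszul_deg i.+1 g /\
    f = koszul_diff y g +
        \sum_(l | deg l == i) mulr_chain (z l) (unit_chain n (u l)).

Definition koszul_independent := forall i (g : K[V]) (u : L -> V), (0 < i)%N ->
  koszul_deg i.+1 g ->
  \sum_(l | deg l == i) mulr_chain (z l) (unit_chain n (u l)) =
    koszul_diff y g ->
  forall l, deg l = i -> exists v : 'I_n -> V, u l = \sum_j y j *: v j.

Lemma koszul_diff_wedge_units (v : 'I_n -> V) :
  koszul_diff y (\sum_j wedge j (unit_chain n (v j))) =
  unit_chain n (\sum_j y j *: v j).
Proof.
rewrite !linear_sum; apply: eq_bigr => j _ /=.
rewrite koszul_diff_wedge (koszul_deg0_diff _ (@unit_chain_deg _ _ _ _)).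
by rewrite linear0 subr0 linearZ.
Qed.

Lemma wedge_units_deg (v : 'I_n -> V) :
  koszul_deg 1 (\sum_j wedge j (unit_chain n (v j))).
Proof.
move=> J J1; rewrite sum_ffunE big1 // => j _.
by apply: koszul_deg_wedge J1; apply: unit_chain_deg.
Qed.

(** The complex modulo the empty word is a sum, over the last letter [c], of copies
    of itself shifted by [deg c + 1], so by induction the parts of a cycle ending in
    [c] are boundaries as long as their degree is positive.  In degree 0 the part
    is a scalar [u c]; the cycle condition at the empty word makes
    [\sum_c z_c u_c] a Koszul boundary, and independence puts [u c] in [yV].
    What is left lives on the empty word, where it is a combination of the [z l]
    up to a boundary, and [z l] is the boundary of the one-letter word [l]. *)
Theorem gacyclic : koszul_spanned -> koszul_independent ->
  forall i f, gdeg i.+1 f -> gdiff f = 0 -> exists2 g, gdeg i.+2 g & gdiff g = f.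
Proof.
move=> spV inV; elim/ltn_ind => i IH f df fcyc.
(* [g1 c] bounds the part of [f] ending in [c], except when that part has degree
   0, that is when [deg c = i]. *)
have step1 c : exists g : G[V], deg c != i ->
    (forall w (J : {set 'I_n}), (wt (rcons w c) + #|J|)%N != i.+2 -> g w J = 0) /\
    gdiff g = fun w => f (rcons w c).
  have [ci|ci|ci] := ltngtP (deg c) i.
  - have dfc : gdeg (i - (deg c).+1).+1 (fun w => f (rcons w c)).
      by move=> w J Ji; apply: df; rewrite wt_rcons; lia.
    have cfc : gdiff (fun w => f (rcons w c)) = 0.
      by rewrite -[LHS]/(fun w => gdiff f (rcons w c)) fcyc.
    have [|g dg <-] := IH _ _ _ dfc cfc; first by lia.
    exists g => _; split=> // w J Ji; apply: dg.
    by move: Ji; rewrite wt_rcons; lia.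
  - exists 0 => _; split=> [w J _|]; first by rewrite ffunE.
    rewrite linear0; apply/funext => w; rewrite (gdeg_eq0 df) //.
    by rewrite wt_rcons; lia.
  - by exists 0.
have {step1} /boolp.choice [g1 hg1] := step1.
have fi c : deg c = i -> f [:: c] = unit_chain n (f [:: c] set0).
  move=> ci; apply: koszul_deg0E.
  have -> : 0%N = (i.+1 - wt [:: c])%N by rewrite wt_cons wt_nil; lia.
  by apply: gdeg_koszul => //; rewrite wt_cons wt_nil; lia.
have fin c : deg c = i -> exists v : 'I_n -> V,
    f [:: c] set0 = \sum_j y j *: v j.
  move=> ci; have i0 : (0 < i)%N by rewrite -ci.
  apply: (inV i (- f [::] + \sum_(l | deg l != i) mulr_chain (z l) (g1 l [::]))
            (fun l => f [:: l] set0)) => //.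
    rewrite -scaleN1r; apply: koszul_deg_lin.
      by have := gdeg_koszul (w := [::]) df; rewrite wt_nil subn0; apply.
    move=> J Ji; rewrite sum_ffunE big1 // => l li.
    have [g1d _] := hg1 l li.
    have [li2|li2] := leqP (deg l) i.+1; last first.
      rewrite (_ : g1 l [::] = 0) ?linear0 ?ffunE //; apply/ffunP=> A.
      by rewrite g1d ?ffunE //= wt_cons wt_nil; lia.
    apply: (mulr_chain_deg (i := (i.+1 - deg l)%N) (@z_deg l)); last by lia.
    move=> A Ai; apply: g1d; rewrite /= wt_cons wt_nil; move: #|A| Ai => q; lia.
  (* The letters of degree other than [i] contribute boundaries to the cycle
     condition at the empty word. *)
  have := congr1 (fun h : G[V] => h [::]) fcyc.
  rewrite /gdiff (bigID (fun l => deg l == i)) /= => /eqP.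
  rewrite addrCA addr_eq0 => /eqP E.
  under eq_bigr => l /eqP li do rewrite -fi //.
  rewrite E opprD [RHS]linearD linearN [X in _ = _ + X]linear_sum /=.
  congr (_ + _); apply/esym/eqP.
  rewrite -addr_eq0 -big_split /=; apply/eqP.
  apply: big1 => l li; have [_ /(congr1 (fun h : G[V] => h [::]))] := hg1 l li.
  rewrite /gdiff /= => <-; rewrite mulr_chain_diff // linearD /= addrA addNr add0r.
  rewrite linear_sum big1 // => l' _.
  by rewrite /= mulr_chain_mulr_chain.
have step2 c : exists g : G[V],
    (forall w (J : {set 'I_n}), (wt (rcons w c) + #|J|)%N != i.+2 -> g w J = 0) /\
    gdiff g = fun w => f (rcons w c).
  have [ci|ci] := eqVneq (deg c) i; last by exists (g1 c); apply: hg1.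
  have [v hv] := fin c ci.
  exists (fun w => if w is [::] then \sum_j wedge j (unit_chain n (v j)) else 0).
  split=> [[|l w] J Ji|].
  - by apply: wedge_units_deg; move: Ji; rewrite /= wt_cons wt_nil; lia.
  - by rewrite ffunE.
  apply/funext => w; rewrite /gdiff [X in _ + X]big1 ?addr0 => [|l _]; last by rewrite linear0.
  case: w => [|l w]; first by rewrite koszul_diff_wedge_units -hv -fi.
  by rewrite linear0 (gdeg_eq0 df) // wt_rcons wt_cons; lia.
have {step2} /boolp.choice [g2 hg2] := step2.
(* [h] glues the [g2 c] along last letters; only the empty word survives in
   [f - gdiff h]. *)
pose h w := if rev w is c :: v then g2 c (rev v) else 0.
have h_rcons w c : h (rcons w c) = g2 c w by rewrite /h rev_rcons revK.
have dh : gdeg i.+2 h.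
  move=> w J; case/lastP: w => [|w c] Ji; first by rewrite /h /= ffunE.
  by rewrite h_rcons; apply: (hg2 c).1.
have f1_rcons w c : (f - gdiff h) (rcons w c) = 0.
  rewrite -[LHS]/(f (rcons w c) - gdiff h (rcons w c)).
  have <- : gdiff (g2 c) w = f (rcons w c) by rewrite (hg2 c).2.
  apply/eqP; rewrite subr_eq0 /gdiff h_rcons; apply/eqP; congr (_ + _).
  by apply: eq_bigr => l _; rewrite -rcons_cons h_rcons.
have df1 : gdeg i.+1 (f - gdiff h) by apply: gdegD => //; apply: gdegN; apply: gdiff_deg.
have cf1 : koszul_diff y ((f - gdiff h) [::]) = 0.
  have := congr1 (fun h : G[V] => h [::]) (linearB gdiff f (gdiff h)).
  rewrite /= gdiff_gdiff fcyc subr0 {1}/gdiff big1 ?addr0 // => l _.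
  by rewrite -[[:: l]]/(rcons [::] l) f1_rcons linear0.
have := gdeg_koszul (w := [::]) df1; rewrite wt_nil subn0 => /(_ isT) df1'.
have [//|g' [u [dg' hg']]] := spV i.+1 _ _ df1' cf1.
pose g3 (w : seq L) := match w with
  | [::] => g' | [:: l] => if deg l == i.+1 then unit_chain n (u l) else 0
  | _ => 0 end.
have dg3 : gdeg i.+2 g3.
  move=> [|l [|l' w]] J Ji; rewrite /g3 /=.
  - by apply: dg'; move: Ji; rewrite wt_nil.
  - case: eqP => li; last by rewrite ffunE.
    by apply: unit_chain_deg; move: Ji; rewrite wt_cons wt_nil; lia.
  - by rewrite ffunE.
exists (h + g3); first exact: gdegD.
rewrite linearD /=; suff -> : gdiff g3 = f - gdiff h by rewrite addrC subrK.
apply/funext => w; case/lastP: w => [|w c].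
  rewrite hg' /gdiff /=; congr (_ + _); rewrite [RHS]big_mkcond /=.
  by apply: eq_bigr => l _; case: ifP => // _; rewrite linear0.
rewrite f1_rcons /gdiff big1 ?addr0 => [|l _]; last first.
  by case: w => [|? ?] /=; rewrite linear0.
case: w => [|l [|l' w]] /=; rewrite ?linear0 //.
case: eqP => _; rewrite ?linear0 //.
by rewrite (koszul_deg0_diff _ (@unit_chain_deg _ _ _ _)).
Qed.

End OneModule.
End TwistedComplex.

(** * Change of module and connecting homomorphisms *)

Section FreeModules.
Variables (R : comNzRingType) (n : nat) (y : 'I_n -> R).
Variables (L : finType) (deg : L -> nat) (z : L -> {ffun {set 'I_n} -> R^o}).

Definition row_coord m (c : 'I_m) (v : 'rV[R]_m) : R^o := v 0 c.

Lemma row_coord_is_linear m c : linear (@row_coord m c).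
Proof. by move=> a u v; rewrite /row_coord !mxE. Qed.
HB.instance Definition _ m (c : 'I_m) := GRing.isLinear.Build R
  'rV[R]_m R^o _ (@row_coord m c) (@row_coord_is_linear m c).

Lemma chain_coordP m (f g : {ffun {set 'I_n} -> 'rV[R]_m}) :
  (forall c, map_chain (@row_coord m c) f = map_chain (@row_coord m c) g) -> f = g.
Proof.
move=> fg; apply/ffunP=> J; apply/rowP=> c.
by have /ffunP/(_ J) := fg c; rewrite !ffunE.
Qed.

Definition row_chain m (g : 'I_m -> {ffun {set 'I_n} -> R^o}) :
  {ffun {set 'I_n} -> 'rV[R]_m} := [ffun J => \row_c g c J].

Lemma row_chainK m (g : 'I_m -> {ffun {set 'I_n} -> R^o}) c :
  map_chain (@row_coord m c) (row_chain g) = g c.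
Proof. by apply/ffunP=> J; rewrite !ffunE /row_coord mxE. Qed.

Lemma koszul_spanned_free m :
  koszul_spanned y deg z R^o -> koszul_spanned y deg z 'rV[R]_m.
Proof.
move=> sp i f i0 df cf.
have /boolp.choice [gu hgu] : forall c, exists gu : {ffun {set 'I_n} -> R^o} * (L -> R^o),
    koszul_deg i.+1 gu.1 /\ map_chain (@row_coord m c) f = koszul_diff y gu.1 +
      \sum_(l | deg l == i) mulr_chain (z l) (unit_chain n (gu.2 l)).
  move=> c; have [|g [u h]] := sp i _ i0 (koszul_deg_map (@row_coord m c) df).
    by rewrite koszul_diff_map cf linear0.
  by exists (g, u).
exists (row_chain (fun c => (gu c).1)), (fun l => \row_c (gu c).2 l); split.
  by move=> J Ji; apply/rowP=> c; rewrite ffunE !mxE (hgu c).1.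
apply: chain_coordP => c; rewrite (hgu c).2 linearD /= -koszul_diff_map row_chainK.
congr (_ + _); rewrite linear_sum; apply: eq_bigr => l _ /=.
by rewrite -mulr_chain_map map_chain_unit /= /row_coord mxE.
Qed.

Lemma koszul_independent_free m :
  koszul_independent y deg z R^o -> koszul_independent y deg z 'rV[R]_m.
Proof.
move=> ind i g u i0 dg E l li.
have /boolp.choice [v hv] : forall c, exists v : 'I_n -> R^o,
    row_coord c (u l) = \sum_j y j *: v j.
  move=> c; apply: (ind i (map_chain (row_coord c) g) (fun l => row_coord c (u l))) => //.
    exact: koszul_deg_map.
  rewrite koszul_diff_map -E linear_sum; apply: eq_bigr => l' _ /=.
  by rewrite -mulr_chain_map map_chain_unit.
exists (fun j => \row_c v c j); apply/rowP=> c.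
rewrite -[LHS]/(row_coord c (u l)) hv summxE; apply: eq_bigr => j _.
by rewrite !mxE.
Qed.

End FreeModules.

Section MaximalIdeal.
Variables (R : comNzRingType) (n : nat) (y : 'I_n -> R).

Definition var_ideal : R -> Prop := gen_ideal (fun x => exists i : 'I_n, x = y i).

Lemma var_idealP x : var_ideal x <-> exists c : 'I_n -> R, x = \sum_j c j * y j.
Proof.
split=> [[r [c [g [/boolp.choice [s hs] ->]]]]|[c ->]].
  exists (fun j => \sum_(i | s i == j) c i).
  rewrite (partition_big s predT) //=; apply: eq_bigr => j _.
  by rewrite mulr_suml; apply: eq_bigr => i /eqP <-; rewrite hs.
by exists n, c, y; split=> // i; exists i.
Qed.

Lemma var_ideal_row m (u : 'rV[R]_m) :
  (forall l, var_ideal (u 0 l)) <-> exists v : 'I_n -> 'rV[R]_m, u = \sum_j y j *: v j.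
Proof.
split=> [uI|[v ->] l].
  have /boolp.choice [c hc] : forall l, exists c : 'I_n -> R, u 0 l = \sum_j c j * y j.
    by move=> l; apply/var_idealP.
  exists (fun j => \row_l c l j); apply/rowP=> l; rewrite hc summxE.
  by apply: eq_bigr => j _; rewrite !mxE mulrC.
apply/var_idealP; exists (fun j => v j 0 l); rewrite summxE.
by apply: eq_bigr => j _; rewrite !mxE mulrC.
Qed.

End MaximalIdeal.

Section TwistedComplexHomology.
Variables (k : fieldType) (R : comNzRingType) (iota : {rmorphism k -> R}).
Variables (n : nat) (y : 'I_n -> R).
Variables (L : finType) (deg : L -> nat) (z : L -> {ffun {set 'I_n} -> R^o}).
Hypothesis deg_gt0 : forall l, (0 < deg l)%N.
Hypothesis z_deg : forall l, koszul_deg (deg l) (z l).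
Hypothesis z_cycle : forall l, koszul_diff y (z l) = 0.
Hypothesis z_mul : forall l l' A B, (z l A : R) * z l' B = 0.
Hypothesis z_span : koszul_spanned y deg z R^o.
Hypothesis z_ind : koszul_independent y deg z R^o.

Local Notation "'G[' V ]" := (seq L -> {ffun {set 'I_n} -> V})
  (format "'G[' V ]").

Section Functoriality.
Variables (V W : lmodType R) (phi : {linear V -> W}).

Definition gmap (f : G[V]) : G[W] := fun w => map_chain phi (f w).

Lemma gmap_is_linear : linear gmap.
Proof. by move=> a f g; apply/funext => w; apply: (linearP (map_chain phi)). Qed.
HB.instance Definition _ := GRing.isLinear.Build R (G[V]) (G[W]) _ gmap
  gmap_is_linear.

Lemma gdiff_map f : gdiff y z (gmap f) = gmap (gdiff y z f).
Proof.
apply/funext => w; rewrite /gmap /gdiff linearD /= koszul_diff_map linear_sum.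
by congr (_ + _); apply: eq_bigr => l _; rewrite mulr_chain_map.
Qed.

Lemma gdeg_map i f : gdeg deg i f -> gdeg deg i (gmap f).
Proof. by move=> df w J Ji; rewrite ffunE df ?linear0. Qed.

End Functoriality.

Section Coefficients.
Variables (V : lmodType R) (Q : V -> Prop).

Definition gin (f : G[V]) := forall w J, Q (f w J).

(** Homology of the twisted complex of the submodule [Q] of [V]; keeping [V] as the
    ambient module lets syzygies be handled inside free modules. *)
Definition gcycle i f := [/\ gdeg deg i f, gin f & gdiff y z f = 0].
Definition gboundary i f :=
  exists g : G[V], [/\ gdeg deg i.+1 g, gin g & gdiff y z g = f].

Lemma gboundary0P (h : G[V]) : submod Q -> gdeg deg 0 h ->
  gboundary 0 h <->
  exists2 v : 'I_n -> V, forall j, Q (v j) & h [::] set0 = \sum_j y j *: v j.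
Proof.
move=> sQ dh; split=> [[g [dg Qg <-]]|[v Qv hv]].
  exists (fun j => g [::] (j |: set0)) => //.
  rewrite /gdiff [X in _ + X]big1 ?addr0 => [|l _]; last first.
    rewrite (gdeg_eq0 dg) ?linear0 // wt_cons wt_nil addn0 ltnS.
    exact: deg_gt0.
  rewrite ffunE; apply: eq_big => [j|j _]; first by rewrite inE.
  rewrite (_ : [set l in _ | _] = set0) ?cards0 ?expr0 ?mul1r //.
  by apply/setP=> l; rewrite !inE.
exists (fun w => if w is [::] then \sum_j wedge j (unit_chain n (v j)) else 0).
split=> [[|l w] J Ji|[|l w] J|].
- by apply: wedge_units_deg; move: Ji; rewrite wt_nil.
- by rewrite ffunE.
- rewrite sum_ffunE; apply: submod_sum => // j _; rewrite !ffunE.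
  case: ifP => _; last exact: submod0.
  by apply: submodZ => //; case: ifP => _ //; apply: submod0.
- by rewrite ffunE; apply: submod0.
apply/funext => w; rewrite /gdiff [X in _ + X]big1 ?addr0 => [|l _].
  case: w => [|l w].
    rewrite koszul_diff_wedge_units -hv -koszul_deg0E // => J J0.
    by apply: dh; rewrite wt_nil.
  by rewrite linear0 (gdeg_eq0 dh) // wt_cons.
by rewrite linear0.
Qed.

End Coefficients.

Lemma submodT (V : lmodType R) : submod (fun _ : V => True).
Proof. by []. Qed.

Section Presentation.
Variables (m : nat) (V : lmodType R) (eps : {linear 'rV[R]_m -> V}).
Variable Q : V -> Prop.
Hypothesis Q_im : forall x, Q x <-> exists v, x = eps v.

Lemma submod_im : submod Q.
Proof.
split=> [|a u v /Q_im [u' ->] /Q_im [v' ->]]; apply/Q_im.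
  by exists 0; rewrite linear0.
by exists (a *: u' + v'); rewrite linearP.
Qed.

Lemma gmap_lift i (f : G[V]) : gdeg deg i f -> gin Q f ->
  exists2 g, gdeg deg i g & gmap eps g = f.
Proof.
move=> df Qf.
have /boolp.choice [s hs] : forall p : seq L * {set 'I_n},
    exists v, f p.1 p.2 = eps v by move=> p; apply/Q_im.
exists (fun w => [ffun J : {set 'I_n} =>
    if (wt deg w + #|J|)%N == i then s (w, J) else 0]).
  by move=> w J Ji; rewrite ffunE (negPf Ji).
apply/funext => w; apply/ffunP=> J; rewrite !ffunE.
case: eqVneq => Ji; first by rewrite -(hs (w, J)).
by rewrite linear0 df.
Qed.

(** The twisted complex of a free module is acyclic, so the connecting
    homomorphism of [0 -> ker eps -> F -> Q -> 0] shifts degrees. *)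
Lemma connecting_basis i T :
  has_quot_basis iota (gcycle Q i.+1) (gboundary Q i.+1) T ->
  has_quot_basis iota
    (fun h => gcycle (fun v => eps v = 0) i h /\ gboundary (fun=> True) i h)
    (gboundary (fun v => eps v = 0) i) T.
Proof.
have acyc := gacyclic deg_gt0 z_deg z_cycle z_mul
  (koszul_spanned_free (m := m) z_span) (koszul_independent_free (m := m) z_ind).
have gd2 := gdiff_gdiff z_cycle z_mul.
apply: (quot_basis_transfer
  (rho := fun f h => exists g, [/\ gdeg deg i.+1 g, gmap eps g = f & gdiff y z g = h])).
- by exists 0; split; rewrite ?linear0 // => w J _; rewrite ffunE.
- move=> a f1 f2 h1 h2 [g1 [d1 <- <-]] [g2 [d2 <- <-]].
  by exists (a *: g1 + g2); split; rewrite ?linearP //; apply: gdeg_lin.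
- move=> f [df Qf cf]; have [g dg gf] := gmap_lift df Qf.
  exists (gdiff y z g); last by exists g.
  split; last by exists g.
  split; [exact: gdiff_deg | move=> w J | exact: gd2].
  have := congr1 (fun F : G[V] => F w J) cf.
  by rewrite -gf gdiff_map /gmap !ffunE.
- move=> h [[dh kh _] [g [dg _ gh]]]; exists (gmap eps g); last by exists g.
  split; first exact: gdeg_map.
    by move=> w J; apply/Q_im; rewrite ffunE; exists (g w J).
  rewrite gdiff_map gh; apply/funext => w; apply/ffunP=> J.
  by rewrite !ffunE kh.
- move=> f h [g [dg gf gh]]; split=> [[f' [df' Qf' ff']]|[g' [dg' kg' hg']]].
    have [g' dg' gf'] := gmap_lift df' Qf'.
    exists (g - gdiff y z g'); split.
    + by apply: gdegD => //; apply: gdegN; apply: gdiff_deg.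
    + move=> w J.
      have : gmap eps (g - gdiff y z g') = 0.
        by rewrite linearB /= gf -gdiff_map gf' ff' subrr.
      by move=> /(congr1 (fun F : G[V] => F w J)); rewrite /gmap !ffunE.
    + by rewrite linearB /= gd2 subr0.
  have [|| g2 dg2 hg2] := acyc i (g - g').
  + by apply: gdegD => //; apply: gdegN.
  + by rewrite linearB /= gh hg' subrr.
  exists (gmap eps g2); split; first exact: gdeg_map.
    by move=> w J; apply/Q_im; rewrite ffunE; exists (g2 w J).
  rewrite gdiff_map hg2 linearB /= gf; apply/funext => w; apply/ffunP=> J.
  by rewrite -[LHS]/((f w - map_chain eps (g' w)) J) !ffunE kg' subr0.
Qed.

(** [H_0] of the twisted complex of [Q] is [Q / yQ], which is the quotient of the
    free module by [yF] and the kernel of [eps].  The predicate [X] cuts out the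
    subspace that [connecting_basis] produces in degree 0. *)
Lemma degree0_basis (X : V -> Prop) T :
  has_quot_basis iota (fun h => gcycle Q 0 h /\ X (h [::] set0)) (gboundary Q 0) T ->
  has_quot_basis iota (fun v => X (eps v))
    (fun v => exists w, eps w = 0 /\ forall l, var_ideal y ((v - w) 0 l)) T.
Proof.
apply: (quot_basis_transfer
  (rho := fun h v => gdeg deg 0 h /\ h [::] set0 = eps v)).
- by split; rewrite ?linear0 ?ffunE // => w J _; rewrite ffunE.
- move=> a h1 h2 v1 v2 [d1 e1] [d2 e2]; split; first exact: gdeg_lin.
  by rewrite linearP -e1 -e2 -[LHS]/((a *: h1 [::] + h2 [::]) set0) !ffunE.
- move=> h [[dh Qh ch] Xh]; have /Q_im [v hv] := Qh [::] set0.
  by exists v; rewrite -?hv.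
- move=> v Xv; exists (fun w => if w is [::] then unit_chain n (eps v) else 0).
    split; last by rewrite ffunE eqxx.
    split=> [[|l w] J Ji|[|l w] J|].
    + by apply: unit_chain_deg; move: Ji; rewrite wt_nil.
    + by rewrite ffunE.
    + rewrite ffunE; case: ifP => _; last exact: submod0 submod_im.
      by apply/Q_im; exists v.
    + by rewrite ffunE; apply: submod0 submod_im.
    apply/funext => w; rewrite /gdiff big1 ?addr0 => [|l _]; last by rewrite linear0.
    case: w => [|l w]; last by rewrite linear0.
    by rewrite koszul_deg0_diff //; apply: unit_chain_deg.
  split; last by rewrite ffunE eqxx.
  move=> [|l w] J Ji; last by rewrite ffunE.
  by apply: unit_chain_deg; move: Ji; rewrite wt_nil.
- move=> h v [dh hv]; rewrite (gboundary0P submod_im dh) hv; split.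
    move=> [x /(_ _)/Q_im-/boolp.choice [u hu] vx].
    exists (v - \sum_j y j *: u j); split.
      rewrite linearB linear_sum vx; apply/eqP; rewrite subr_eq0; apply/eqP.
      by apply: eq_bigr => j _; rewrite linearZ hu.
    by apply/var_ideal_row; exists u; rewrite subKr.
  move=> [w [w0 /var_ideal_row [u hu]]]; exists (fun j => eps (u j)).
    by move=> j; apply/Q_im; exists (u j).
  rewrite -[v](subrK w) linearD w0 addr0 hu linear_sum.
  by apply: eq_bigr => j _; rewrite linearZ.
Qed.

End Presentation.

End TwistedComplexHomology.

(** * Tor and the homology of the twisted complex *)

Section TwistedComplexAndTor.
Variables (k : fieldType) (R : comNzRingType) (iota : {rmorphism k -> R}).
Variables (n : nat) (y : 'I_n -> R).
Variables (L : finType) (deg : L -> nat) (z : L -> {ffun {set 'I_n} -> R^o}).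
Hypothesis deg_gt0 : forall l, (0 < deg l)%N.
Hypothesis z_deg : forall l, koszul_deg (deg l) (z l).
Hypothesis z_cycle : forall l, koszul_diff y (z l) = 0.
Hypothesis z_mul : forall l l' A B, (z l A : R) * z l' B = 0.
Hypothesis z_span : koszul_spanned y deg z R^o.
Hypothesis z_ind : koszul_independent y deg z R^o.

Local Notation "'G[' V ]" := (seq L -> {ffun {set 'I_n} -> V})
  (format "'G[' V ]").
Local Notation gcycle := (gcycle y deg z).
Local Notation gboundary := (gboundary y deg z).

Section Tor.
Variables (M : lmodType R) (F : free_resolution M).

(** [k (x) F] is [F] modulo the ideal generated by [y], so its cycles and boundaries
    are read modulo that ideal. *)
Definition tor_cycles (i : nat) : 'rV[R]_(rk F i) -> Prop :=
  match i with
  | 0 => fun=> True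
  | j.+1 => fun v => forall l, var_ideal y ((v *m diff F j) 0 l)
  end.

Definition tor_boundaries (i : nat) (v : 'rV[R]_(rk F i)) : Prop :=
  exists w, forall l, var_ideal y ((v - w *m diff F i) 0 l).

Definition syzygies p (v : 'rV[R]_(rk F p)) := exists w, v = w *m diff F p.

(** Each connecting homomorphism lowers the degree by one and replaces a syzygy
    module by the next, until degree 0 where [degree0_basis] applies. *)
Lemma tor_basis_syzygies p i j T : j = (p + i).+1 ->
  has_quot_basis iota
    (fun h => gcycle (@syzygies p) i h /\ gboundary (fun=> True) i h)
    (gboundary (@syzygies p) i) T ->
  has_quot_basis iota (@tor_cycles j) (@tor_boundaries j) T.
Proof.
elim: i j p => [|i IH] j p -> hT.
  rewrite addn0.
  pose X (x : 'rV[R]_(rk F p)) := exists v, x = \sum_j y j *: (v j : 'rV[R]_(rk F p)).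
  have im : forall x, syzygies x <-> exists v, x = mulmxr (diff F p) v by [].
  have hX : has_quot_basis iota
      (fun h => gcycle (@syzygies p) 0 h /\ X (h [::] set0))
      (gboundary (@syzygies p) 0) T.
    apply: quot_basis_iff hT => // h; split=> -[ch].
      move=> /(gboundary0P y z deg_gt0 (submodT _) (let: And3 d _ _ := ch in d)).
      by case=> v _ hv; split=> //; exists v.
    case=> v hv; split=> //.
    by apply/(gboundary0P y z deg_gt0 (submodT _) (let: And3 d _ _ := ch in d)); exists v.
  have := degree0_basis deg_gt0 im hX; apply: quot_basis_iff => v /=.
    by rewrite /X; split=> /var_ideal_row.
  split=> [[w [/exact_diff [w' ->] wv]]|[w wv]]; first by exists w'.
  exists (w *m diff F p.+1); split=> //.
  by apply/exact_diff; exists w.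
apply: (IH _ p.+1); first by rewrite addSnnS.
have acyc := gacyclic deg_gt0 z_deg z_cycle z_mul
  (koszul_spanned_free (m := rk F p) z_span)
  (koszul_independent_free (m := rk F p) z_ind).
have im : forall x, syzygies x <-> exists v, x = mulmxr (diff F p) v by [].
have {}hT : has_quot_basis iota (gcycle (@syzygies p) i.+1)
    (gboundary (@syzygies p) i.+1) T.
  apply: quot_basis_iff hT => // h; split=> [[]//|ch]; split=> //.
  case: ch => dh _ ch; have [g dg gh] := acyc i h dh ch.
  by exists g.
have := connecting_basis deg_gt0 z_deg z_cycle z_mul z_span z_ind im hT.
have ker_syz : (fun v => mulmxr (diff F p) v = 0) = @syzygies p.+1.
  by apply/funext => v; apply/propext; apply: exact_diff.
by rewrite ker_syz.
Qed.

(** Balancing of [Tor(k, M)]: the left side resolves [k] by the twisted complex of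
    [R], the right side resolves [M] by [F]. *)
Theorem tor_basis i T :
  has_quot_basis iota (gcycle (fun _ : M => True) i)
    (gboundary (fun _ : M => True) i) T ->
  has_quot_basis iota (@tor_cycles i) (@tor_boundaries i) T.
Proof.
have im : forall x : M, True <-> exists v, x = aug F v.
  by move=> x; split=> // _; have [v <-] := aug_surj F x; exists v.
case: i => [|i] hT.
  have hX : has_quot_basis iota (fun h => gcycle (fun _ : M => True) 0 h /\ True)
      (gboundary (fun _ : M => True) 0) T.
    by apply: quot_basis_iff hT => // h; split=> // -[].
  have := degree0_basis (X := fun=> True) deg_gt0 im hX.
  apply: quot_basis_iff => // v.
  split=> [[w [/exact_aug [w' ->] wv]]|[w wv]]; first by exists w'.
  by exists (w *m diff F 0); split=> //; apply/exact_aug; exists w.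
apply: (@tor_basis_syzygies 0 i) => //.
have := connecting_basis deg_gt0 z_deg z_cycle z_mul z_span z_ind im hT.
have ker_syz : (fun v => aug F v = 0) = @syzygies 0.
  by apply/funext => v; apply/propext; apply: exact_aug.
by rewrite ker_syz.
Qed.

End Tor.

Section TrivialAction.
Variable M : lmodType R.
Hypothesis z_kill : forall l A (x : M), (z l A : R) *: x = 0.
Local Notation gcycleM := (gcycle (fun _ : M => True)).
Local Notation gboundaryM := (gboundary (fun _ : M => True)).

Lemma gdiff_trivial (f : G[M]) w : gdiff y z f w = koszul_diff y (f w).
Proof.
rewrite /gdiff big1 ?addr0 // => l _; apply: mulr_chain0 => A J; exact: z_kill.
Qed.

Lemma gdeg_cons i (f : G[M]) l : (deg l < i)%N -> gdeg deg i f ->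
  gdeg deg (i - (deg l).+1)%N (fun w => f (l :: w)).
Proof. by move=> li df w J Ji; apply: df; rewrite wt_cons; lia. Qed.

Lemma gdeg_nil i (f : G[M]) : gdeg deg i f -> koszul_deg i (f [::]).
Proof. by move=> df J Ji; apply: df; rewrite wt_nil. Qed.

Lemma gcycle_split i (f : G[M]) : gcycleM i f <->
  koszul_cycle y i (f [::]) /\ forall l,
    if (deg l < i)%N then gcycleM (i - (deg l).+1)%N (fun w => f (l :: w))
    else (fun w => f (l :: w)) = 0.
Proof.
split=> [[df _ cf]|[[df0 cf0] fl]].
  have cfw w : koszul_diff y (f w) = 0 by rewrite -gdiff_trivial cf.
  split=> [|l]; first by split=> //; apply: gdeg_nil.
  case: ifP => li; last first.
    by apply/funext => w; rewrite (gdeg_eq0 df) // wt_cons; lia.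
  split=> //; first exact: gdeg_cons.
  by apply/funext => w; rewrite gdiff_trivial cfw.
split=> // [[|l w] J Ji|].
- by apply: df0; move: Ji; rewrite wt_nil.
- have := fl l; case: ifP => li; last first.
    by move=> /(congr1 (fun F : G[M] => F w J)) /=; rewrite ffunE.
  by move=> [df _ _]; apply: df; move: Ji; rewrite wt_cons; lia.
apply/funext => -[|l w]; rewrite gdiff_trivial //.
have := fl l; case: ifP => li; last first.
  by move/(congr1 (fun F : G[M] => F w)) => /= ->; rewrite linear0.
by case=> _ _ /(congr1 (fun F : G[M] => F w)); rewrite gdiff_trivial.
Qed.

Lemma gboundary_split i (f : G[M]) : gboundaryM i f <->
  koszul_boundary y i (f [::]) /\ forall l,
    if (deg l < i)%N then gboundaryM (i - (deg l).+1)%N (fun w => f (l :: w))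
    else (fun w => f (l :: w)) = 0.
Proof.
split=> [[g [dg _ gf]]|[[g0 dg0 fg0]] fl].
  have df : gdeg deg i f by rewrite -gf; apply: gdiff_deg.
  split=> [|l].
    by exists (g [::]); [exact: gdeg_nil | rewrite -gf gdiff_trivial].
  case: ifP => li; last first.
    by apply/funext => w; rewrite (gdeg_eq0 df) // wt_cons; lia.
  exists (fun w => g (l :: w)); split=> //.
    by rewrite -subSn //; apply: gdeg_cons => //; lia.
  by apply/funext => w; rewrite gdiff_trivial -gf gdiff_trivial.
have /boolp.choice [g hg] : forall l, exists g : G[M],
    (forall w (J : {set 'I_n}), (wt deg (l :: w) + #|J|)%N != i.+1 -> g w J = 0) /\
    forall w, f (l :: w) = koszul_diff y (g w).
  move=> l; have := fl l; case: ifP => li.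
    move=> [g [dg _ gf]]; exists g; split=> [w J Ji|w].
      by apply: dg; move: Ji; rewrite wt_cons; lia.
    by have := congr1 (fun F : G[M] => F w) gf; rewrite /= gdiff_trivial.
  move=> f0; exists 0; split=> [w J _|w]; first by rewrite ffunE.
  by have /= -> := congr1 (fun F : G[M] => F w) f0; rewrite linear0.
exists (fun w => if w is l :: w' then g l w' else g0); split=> //.
  move=> [|l w] J Ji; last exact: (hg l).1.
  by apply: dg0; move: Ji; rewrite wt_nil.
by apply/funext => -[|l w]; rewrite gdiff_trivial ?fg0 // (hg l).2.
Qed.

(** With trivial action the complex splits according to the first letter of the
    words: the empty word gives [K (x) M], and the words starting with [l] give the
    whole complex shifted by [deg l + 1]. *)
Lemma twisted_basis_step i (T0 : finType) (T : L -> finType) :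
  has_quot_basis iota (koszul_cycle (V := M) y i) (koszul_boundary y i) T0 ->
  (forall l, (deg l < i)%N ->
     has_quot_basis iota (gcycleM (i - (deg l).+1)%N) (gboundaryM (i - (deg l).+1)%N) (T l)) ->
  (forall l, (i <= deg l)%N -> #|T l| = 0%N) ->
  has_quot_basis iota (gcycleM i) (gboundaryM i) (T0 + {l : L & T l})%type.
Proof.
move=> [e0 [Z0 sp0 ind0]] hT T_empty.
have Tno l : (deg l < i)%N = false -> T l -> False.
  by move=> li t; have := T_empty l; rewrite leqNgt li => /(_ isT)/card0_eq/(_ t).
have exE : forall l, exists e : T l -> G[M],
    (deg l < i)%N -> quot_basis iota (gcycleM (i - (deg l).+1)%N)
      (gboundaryM (i - (deg l).+1)%N) e.
  move=> l; have [li|li] := boolP (deg l < i)%N; last by exists (fun=> 0).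
  by have [e he] := hT l li; exists e.
pose e l := sval (cid (exE l)).
have he l := svalP (cid (exE l)) : (_ -> quot_basis _ _ _ (e l)).
pose E (t : T0 + {l : L & T l}) : G[M] := fun w => match t, w with
  | inl t0, [::] => e0 t0
  | inr u, l :: w' => if tag u == l then e (tag u) (tagged u) w' else 0
  | _, _ => 0 end.
have E0 (c : T0 + {l : L & T l} -> k) :
    (\sum_t iota (c t) *: E t) [::] = \sum_t iota (c (inl t)) *: e0 t.
  rewrite fct_sumE big_sumType /= [X in _ + X]big1 ?addr0 // => u _.
  by rewrite -[LHS]/(iota (c (inr u)) *: 0) scaler0.
have El (c : T0 + {l : L & T l} -> k) l :
    (fun w => (\sum_t iota (c t) *: E t) (l :: w)) =
    \sum_(t : T l) iota (c (inr (Tagged T t))) *: e l t.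
  apply/funext => w; rewrite !fct_sumE big_sumType /= big1 ?add0r => [|t _]; last first.
    by rewrite -[LHS]/(iota (c (inl t)) *: 0) scaler0.
  transitivity (\sum_l' \sum_(t : T l') iota (c (inr (Tagged T t))) *:
      (if l' == l then e l' t w else 0)).
    by rewrite sig_big_dep /=; apply: eq_bigr => -[].
  rewrite (bigD1 l) //= eqxx [X in _ + X]big1 ?addr0 // => l' /negPf ll.
  by rewrite big1 // => t _; rewrite ll scaler0.
exists E; split=> [t|f /gcycle_split [cf0 cfl]|c /gboundary_split [bf0 bfl] t].
- apply/gcycle_split; case: t => [t|[l t]]; split.
  + exact: Z0.
  + move=> l; case: ifP => li //; split=> [w J _||] //.
      by rewrite /E ffunE.
    by rewrite -[LHS]/(gdiff y z 0) linear0.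
  + split=> [J _|]; first by rewrite /E ffunE.
    by rewrite /E linear0.
  + move=> l'; rewrite /E /=; case: eqVneq => [<-|ll].
      case: ifP => li; last by have := Tno _ li t.
      by have [Zl _ _] := he l li; apply: Zl.
    case: ifP => li //; split=> [w J _||] //; first by rewrite ffunE.
    by rewrite -[LHS]/(gdiff y z 0) linear0.
- have [c0 hc0] := sp0 _ cf0.
  have exC : forall l, exists c : T l -> k, (deg l < i)%N ->
      gboundaryM (i - (deg l).+1)%N ((fun w => f (l :: w)) - \sum_t iota (c t) *: e l t).
    move=> l; have := cfl l; case: ifP => li fl; last by exists (fun=> 0).
    have [_ sp _] := he l li; have [c hc] := sp _ fl.
    by exists c.
  pose c l := sval (cid (exC l)).
  have hc l := svalP (cid (exC l)) :
    (_ -> gboundaryM _ (_ - \sum_t iota (c l t) *: e l t)).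
  pose c1 (t : T0 + {l : L & T l}) :=
    match t with inl t => c0 t | inr u => c (tag u) (tagged u) end.
  exists c1.
  apply/gboundary_split; split.
    by rewrite -[X in koszul_boundary _ _ X]/(f [::] - (\sum_t iota (c1 t) *: E t) [::]) E0.
  move=> l; have -> : (fun w => (f - \sum_t iota (c1 t) *: E t) (l :: w)) =
      (fun w => f (l :: w)) - \sum_t iota (c l t) *: e l t.
    by rewrite -(El c1 l).
  have := cfl l; have := hc l; case: ifP => li // => [/(_ isT) //|_ ->].
  by rewrite big1 ?subrr // => t; have := Tno _ li t.
case: t => [t|[l t]].
  by move: bf0; rewrite E0 => /ind0.
have := bfl l; rewrite El; case: ifP => li; last by have := Tno _ li t.
by have [_ _ indl] := he l li; move=> /indl/(_ t).
Qed.

(** The coefficients of [kappa / (1 - \sum_l t ^ (deg l + 1))], computed with [fuel]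
    since the recursion is on the degree and not structural. *)
Fixpoint golod_rec (kappa : nat -> nat) (fuel i : nat) : nat :=
  if fuel is fuel'.+1 then
    (kappa i + \sum_l (if (deg l < i)%N
                       then golod_rec kappa fuel' (i - (deg l).+1)%N else 0))%N
  else 0%N.

Lemma golod_rec_fuel kappa fuel1 fuel2 i : (i < fuel1)%N -> (i < fuel2)%N ->
  golod_rec kappa fuel1 i = golod_rec kappa fuel2 i.
Proof.
elim: fuel1 fuel2 i => [|f1 IH] [|f2] i //= i1 i2; congr (_ + _)%N.
by apply: eq_bigr => l _; case: ifP => // li; apply: IH; lia.
Qed.

Definition golod_coef kappa i := golod_rec kappa i.+1 i.

Lemma golod_coefE kappa i : golod_coef kappa i =
  (kappa i + \sum_l (if (deg l < i)%N then golod_coef kappa (i - (deg l).+1)%N else 0))%N.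
Proof.
rewrite {1}/golod_coef /=; congr (_ + _)%N; apply: eq_bigr => l _.
by case: ifP => // li; apply: golod_rec_fuel; lia.
Qed.

Theorem twisted_basis kappa i :
  (forall i, has_quot_basis iota (koszul_cycle (V := M) y i) (koszul_boundary y i)
     'I_(kappa i)) ->
  exists2 T : finType, #|T| = golod_coef kappa i &
    has_quot_basis iota (gcycleM i) (gboundaryM i) T.
Proof.
move=> hk; elim/ltn_ind: i => i IH.
have /boolp.choice [T hT] : forall l, exists T : finType,
    if (deg l < i)%N then #|T| = golod_coef kappa (i - (deg l).+1)%N /\
       has_quot_basis iota (gcycleM (i - (deg l).+1)%N) (gboundaryM (i - (deg l).+1)%N) T
    else #|T| = 0%N.
  move=> l; have [li|li] := boolP (deg l < i)%N; last by exists void; rewrite card_void.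
  have [|T cT hT] := IH (i - (deg l).+1)%N; first by lia.
  by exists T.
exists ('I_(kappa i) + {l : L & T l})%type.
  rewrite card_sum card_ord golod_coefE; congr (_ + _)%N.
  rewrite card_tagged sumnE big_map big_enum /=; apply: eq_bigr => l _.
  by have := hT l; case: ifP => _ // -[].
apply: twisted_basis_step => [//|l li|l li].
  by have := hT l; rewrite li => -[].
by have := hT l; rewrite ltnNge li.
Qed.

End TrivialAction.

Lemma golod_coef_series (kappa kappaR : nat -> nat) i :
  kappaR 0 = 1%N -> (forall m, (0 < m)%N -> kappaR m = #|[pred l | deg l == m]|) ->
  series_mul (fun j => (golod_coef kappa j)%:Z) (golod_denominator kappaR) i =
  (kappa i)%:Z.
Proof.
move=> k0 km; rewrite /series_mul big_ord_recr /= subnn mulr1.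
rewrite [golod_coef kappa i]golod_coefE PoszD addrCA.
suff -> : \sum_(j < i) (golod_coef kappa j)%:Z * golod_denominator kappaR (i - j) =
   - (\sum_l (if (deg l < i)%N then golod_coef kappa (i - (deg l).+1)%N else 0))%N%:Z.
  by rewrite addNr addr0.
transitivity (- \sum_(j < i) \sum_(l | deg l == (i - j.+1)%N) (golod_coef kappa j)%:Z).
  rewrite -sumrN; apply: eq_bigr => j _.
  rewrite (_ : (i - j)%N = (i - j.+1).+1); last by have := ltn_ord j; lia.
  rewrite /= mulrN sumr_const; congr (- _).
  have [E|E] := posnP (i - j.+1)%N.
    rewrite E k0 subrr mulr0 (_ : #|_| = 0%N) // ; apply: eq_card0 => l.
    by rewrite !inE; apply/negbTE; rewrite -lt0n.
  by rewrite km // subr0 -mulr_natr natz.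
congr (- _); rewrite (exchange_big_dep predT) //=.
rewrite (big_morph Posz PoszD (erefl (Posz 0))); apply: eq_bigr => l _.
case: ifP => li; last by rewrite big_pred0 // => j; have := ltn_ord j; lia.
have lt : (i - (deg l).+1 < i)%N by lia.
rewrite (big_pred1 (Ordinal lt)) // => j; apply/eqP/eqP => [E|-> /=]; last lia.
by apply/val_inj => /=; have := ltn_ord j; lia.
Qed.

End TwistedComplexAndTor.

(** * Noetherian modules, free resolutions, finiteness of Koszul homology *)

Section FiniteGeneration.
Variable R : comNzRingType.

Definition span_of (V : lmodType R) r (e : 'I_r -> V) (x : V) :=
  exists c : 'I_r -> R, x = \sum_i c i *: e i.

Lemma span_of_submod (V : lmodType R) r (e : 'I_r -> V) : submod (span_of e).
Proof.
split=> [|a u v [c ->] [b ->]].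
  by exists (fun=> 0); rewrite big1 // => i _; rewrite scale0r.
exists (fun i => a * c i + b i); rewrite scaler_sumr -big_split /=.
by apply: eq_bigr => i _; rewrite scalerDl scalerA.
Qed.

Lemma span_of_gen (V : lmodType R) r (e : 'I_r -> V) i : span_of e (e i).
Proof.
exists (fun j => (j == i)%:R); rewrite (bigD1 i) //= eqxx scale1r big1 ?addr0 //.
by move=> j /negPf->; rewrite scale0r.
Qed.

Definition fgen (V : lmodType R) (Q : V -> Prop) :=
  exists r (e : 'I_r -> V), (forall i, Q (e i)) /\ forall x, Q x -> span_of e x.

Definition noetherian (V : lmodType R) := forall Q : V -> Prop, submod Q -> fgen Q.

(** Spanning phrased as membership in every submodule containing the generators,
    which avoids manipulating coefficients. *)
Lemma fgen_seq (V : lmodType R) (Q : V -> Prop) (s : seq V) :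
  (forall x, x \in s -> Q x) ->
  (forall B, submod B -> (forall x, x \in s -> B x) -> forall x, Q x -> B x) ->
  fgen Q.
Proof.
move=> sQ sp; exists (size s), (fun i => s`_i); split=> [i|x Qx].
  by apply: sQ; apply: mem_nth.
apply: sp Qx => [|v /(nthP 0) [i si <-]]; first exact: span_of_submod.
exact: (span_of_gen (fun i : 'I_(size s) => s`_i) (Ordinal si)).
Qed.

Lemma fgen_seqE (V : lmodType R) (Q : V -> Prop) : fgen Q ->
  exists s : seq V, (forall x, x \in s -> Q x) /\
    forall B, submod B -> (forall x, x \in s -> B x) -> forall x, Q x -> B x.
Proof.
move=> [r [e [eQ sp]]]; exists [seq e i | i <- enum 'I_r]; split.
  by move=> x /mapP [i _ ->].
move=> B sB eB x /sp [c ->]; apply: submod_sum => // i _; apply: submodZ => //.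
by apply: eB; apply: map_f; rewrite mem_enum.
Qed.

(** Generators of the image, lifted, together with generators of the kernel. *)
Lemma fgen_ext (V W : lmodType R) (phi : {linear V -> W}) (Q : V -> Prop) :
  submod Q ->
  fgen (fun w => exists2 v, Q v & phi v = w) -> fgen (fun v => Q v /\ phi v = 0) ->
  fgen Q.
Proof.
move=> sQ /fgen_seqE [s [sQ' sps]] /fgen_seqE [t [tQ spt]].
have /boolp.choice [h hh] : forall w, exists v, w \in s -> Q v /\ phi v = w.
  move=> w; have [ws|ws] := boolP (w \in s); last by exists 0.
  by have [v Qv vw] := sQ' w ws; exists v.
apply: (@fgen_seq _ _ ([seq h w | w <- s] ++ t)).
  move=> x; rewrite mem_cat => /orP [/mapP [w ws ->]|/tQ []//].
  exact: (hh w ws).1.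
move=> B sB hB x Qx.
have [v [Bv Qv] vx] : exists2 v, B v /\ Q v & phi v = phi x.
  apply: (sps (fun w => exists2 v, B v /\ Q v & phi v = w)); last by exists x.
    split=> [|a _ _ [u [Bu Qu] <-] [v [Bv Qv] <-]].
      by exists 0; rewrite ?linear0 //; split; apply: submod0.
    by exists (a *: u + v); [split; [apply: sB.2|apply: sQ.2]|rewrite linearP].
  move=> w ws; exists (h w); last exact: (hh w ws).2.
  by split; [apply: hB; rewrite mem_cat map_f|exact: (hh w ws).1].
rewrite -[x](subrK v); apply: submodD => //; apply: (spt _ sB).
  by move=> u ut; apply: hB; rewrite mem_cat ut orbT.
by split; [apply: submodB|rewrite linearB /= vx subrr].
Qed.

Lemma noetherian_image (V W : lmodType R) (phi : {linear V -> W}) :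
  (forall w, exists v, phi v = w) -> noetherian V -> noetherian W.
Proof.
move=> surj nV Q sQ.
have sQ' : submod (fun v => Q (phi v)).
  split=> [|a u v Qu Qv]; first by rewrite linear0; apply: submod0.
  by rewrite linearP; apply: sQ.2.
have /fgen_seqE [s [sQ1 sps]] := nV _ sQ'.
apply: (@fgen_seq _ _ [seq phi v | v <- s]) => [_ /mapP [v vs ->]|B sB hB w].
  exact: sQ1.
have [v <-] := surj w => Qv; apply: (sps (fun v => B (phi v))) => //.
  split=> [|a u u' Bu Bu']; first by rewrite linear0; apply: submod0.
  by rewrite linearP; apply: sB.2.
by move=> u us; apply: hB; apply: map_f.
Qed.

(** Induction on the support, splitting off the evaluation at one point. *)
Lemma noetherian_ffun (T : finType) (V : lmodType R) :
  noetherian V -> noetherian {ffun T -> V}.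
Proof.
move=> nV.
suff H (s : seq T) (Q : {ffun T -> V} -> Prop) : submod Q ->
    (forall f, Q f -> forall t, t \notin s -> f t = 0) -> fgen Q.
  by move=> Q sQ; apply: (H (enum T)) => // f _ t; rewrite mem_enum.
elim: s Q => [|t s IH] Q sQ Qs.
  apply: (@fgen_seq _ _ [::]) => // B sB _ f /Qs f0.
  by rewrite (_ : f = 0); [apply: submod0|apply/ffunP=> t; rewrite f0 // ffunE].
have ev_lin : linear (fun f : {ffun T -> V} => f t).
  by move=> a f g; rewrite !ffunE.
pose ev := GRing.isLinear.Build R {ffun T -> V} V _ (fun f : {ffun T -> V} => f t) ev_lin.
pose evl : {linear {ffun T -> V} -> V} := HB.pack (fun f : {ffun T -> V} => f t) ev.
apply: (@fgen_ext _ _ evl) => //.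
  apply: nV; split=> [|a _ _ [f Qf <-] [g Qg <-]].
    by exists 0; [apply: submod0|rewrite linear0].
  by exists (a *: f + g); [apply: sQ.2|rewrite linearP].
apply: IH => [|f [Qf /= ft] u us].
  split=> [|a f g [Qf f0] [Qg g0]]; first by split; [apply: submod0|rewrite linear0].
  by split; [apply: sQ.2|rewrite linearP f0 g0 scaler0 addr0].
have [->//|ut] := eqVneq u t.
by apply: (Qs f Qf); rewrite inE negb_or ut.
Qed.

Definition combination (V : lmodType R) r (e : 'I_r -> V) (c : {ffun 'I_r -> R^o}) :=
  \sum_i (c i : R) *: e i.

Lemma combination_is_linear (V : lmodType R) r (e : 'I_r -> V) :
  linear (combination e).
Proof.
move=> a c b; rewrite /combination scaler_sumr -big_split /=; apply: eq_bigr => i _.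
by rewrite !ffunE scalerDl scalerA.
Qed.
HB.instance Definition _ (V : lmodType R) r (e : 'I_r -> V) :=
  GRing.isLinear.Build R {ffun 'I_r -> R^o} V _ (combination e)
  (combination_is_linear e).

Lemma noetherian_fg (V : lmodType R) :
  noetherian R^o -> finitely_generated V -> noetherian V.
Proof.
move=> nR [r [e he]]; apply: (noetherian_image (phi := combination e)) => [v|].
  have [c ->] := he v; exists [ffun i => c i].
  by apply: eq_bigr => i _; rewrite ffunE.
exact: noetherian_ffun.
Qed.

Lemma rV_finitely_generated m : finitely_generated 'rV[R]_m.
Proof.
exists m, (fun i => delta_mx 0 i) => v; exists (fun i => v 0 i).
exact: row_sum_delta.
Qed.

Lemma kernel_matrix p q (A : 'M[R]_(p, q)) : noetherian R^o ->
  exists B : {r & 'M[R]_(r, p)}, forall v : 'rV_p, v *m A = 0 <->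
    exists w, v = w *m tagged B.
Proof.
move=> nR; have nP := noetherian_fg nR (rV_finitely_generated p).
have [|r [e [eA sp]]] := nP (fun v => v *m A = 0).
  split=> [|a u v u0 v0]; first by rewrite mul0mx.
  by rewrite mulmxDl -scalemxAl u0 v0 scaler0 addr0.
exists (Tagged (fun r => 'M[R]_(r, p)) (\matrix_i e i)) => v /=.
split=> [/sp [c ->]|[w ->]].
  exists (\row_i c i); rewrite mulmx_sum_row; apply: eq_bigr => i _.
  by rewrite mxE rowK.
rewrite -mulmxA mulmx_sum_row big1 // => i _.
by rewrite row_mul rowK eA scaler0.
Qed.

Definition row_combination (V : lmodType R) r (e : 'I_r -> V) (c : 'rV[R]_r) :=
  \sum_i c 0 i *: e i.

Lemma row_combination_is_linear (V : lmodType R) r (e : 'I_r -> V) :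
  linear (row_combination e).
Proof.
move=> a c b; rewrite /row_combination scaler_sumr -big_split /=.
by apply: eq_bigr => i _; rewrite !mxE scalerDl scalerA.
Qed.
HB.instance Definition _ (V : lmodType R) r (e : 'I_r -> V) :=
  GRing.isLinear.Build R 'rV[R]_r V _ (row_combination e)
  (row_combination_is_linear e).

Lemma free_resolution_exists (M : lmodType R) :
  noetherian R^o -> finitely_generated M -> inhabited (free_resolution M).
Proof.
move=> nR [r0 [e0 he0]].
pose K p q (A : 'M[R]_(p, q)) := sval (cid (kernel_matrix A nR)).
have hK p q (A : 'M[R]_(p, q)) : forall v : 'rV_p, v *m A = 0 <->
    exists w, v = w *m tagged (K p q A) := svalP (cid (kernel_matrix A nR)).
have [|r1 [e1 [e1k sp1]]] :=
    noetherian_fg nR (rV_finitely_generated r0) (Q := fun v => row_combination e0 v = 0).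
  split=> [|a u v u0 v0]; first by rewrite linear0.
  by rewrite linearP /= u0 v0 scaler0 addr0.
pose step (s : {m & {m' & 'M[R]_(m', m)}}) : {m & {m' & 'M[R]_(m', m)}} :=
  existT _ (projT1 (projT2 s)) (K _ _ (projT2 (projT2 s))).
pose s0 : {m & {m' & 'M[R]_(m', m)}} :=
  existT (fun m => {m' & 'M[R]_(m', m)}) r0
    (existT (fun m' => 'M[R]_(m', r0)) r1 (\matrix_i e1 i)).
pose st := fix st i := if i is j.+1 then step (st j) else s0.
pose rk i := projT1 (st i).
pose df i : 'M[R]_(rk i.+1, rk i) := projT2 (projT2 (st i)).
constructor; apply: (@FreeResolution R M rk df (row_combination e0)).
- move=> m; have [c ->] := he0 m; exists (\row_i c i).
  by apply: eq_bigr => i _; rewrite mxE.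
- move=> v; rewrite /df /=; split=> [/sp1 [c ->]|[w ->]].
    exists (\row_i c i); rewrite mulmx_sum_row; apply: eq_bigr => i _.
    by rewrite mxE rowK.
  rewrite mulmx_sum_row linear_sum big1 // => i _.
  by rewrite rowK linearZ /= e1k scaler0.
- by move=> i v; apply: hK.
Qed.

End FiniteGeneration.

Lemma noetherian_quotient (S R : comNzRingType) (pi : {rmorphism S -> R}) :
  (forall x, exists s, pi s = x) -> noetherian S^o -> noetherian R^o.
Proof.
move=> surj nS Q sQ.
have sQ' : submod (fun s : S^o => Q (pi s)).
  split=> [|a u v Qu Qv]; first by rewrite rmorph0; exact: sQ.1.
  by rewrite rmorphD rmorphM; exact: sQ.2.
have /fgen_seqE [s [sQ1 sps]] := nS _ sQ'.
apply: (@fgen_seq _ _ _ [seq (pi v : R^o) | v <- s]) => [_ /mapP [v vs ->]|B sB hB w].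
  exact: sQ1.
have [v <-] := surj w => Qv; apply: (sps (fun v => B (pi v))) => //.
  split=> [|a u u' Bu Bu']; first by rewrite rmorph0; exact: sB.1.
  by rewrite rmorphD rmorphM; exact: sB.2.
by move=> u us; apply: hB; apply: map_f.
Qed.

Section KoszulHomologyFinite.
Variables (k : fieldType) (R : comNzRingType) (iota : {rmorphism k -> R}).
Variables (n : nat) (y : 'I_n -> R) (V : lmodType R).

Lemma koszul_boundary_submod i : submod (koszul_boundary (V := V) y i).
Proof.
split=> [|a _ _ [f df ->] [g dg ->]].
  by exists 0; rewrite ?linear0 // => J _; rewrite ffunE.
by exists (a *: f + g); [exact: koszul_deg_lin|rewrite linearP].
Qed.

Lemma koszul_cycle_submod i : submod (koszul_cycle (V := V) y i).
Proof.
split=> [|a f g [df cf] [dg cg]].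
  by split; rewrite ?linear0 // => J _; rewrite ffunE.
by split; [exact: koszul_deg_lin|rewrite linearP /= cf cg scaler0 addr0].
Qed.

Lemma koszul_boundary_ideal i x f :
  var_ideal y x -> koszul_cycle (V := V) y i f -> koszul_boundary y i (x *: f).
Proof.
move=> /var_idealP [c ->] [df cf]; rewrite scaler_suml.
apply: submod_sum => [|j _]; first exact: koszul_boundary_submod.
rewrite -scalerA; apply: submodZ; first exact: koszul_boundary_submod.
exists (wedge j f); first exact: koszul_deg_wedge.
by rewrite koszul_diff_wedge cf linear0 subr0.
Qed.

(** Cycles form a finitely generated [R]-module on whose quotient by the
    boundaries the ideal [y] acts as zero, so generators over [R] span over [k]. *)
Lemma koszul_basis_exists i :
  (forall x, exists c, var_ideal y (x - iota c)) -> noetherian V ->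
  exists d, has_quot_basis iota (koszul_cycle (V := V) y i) (koszul_boundary y i) 'I_d.
Proof.
move=> resk nV.
have [r [e [eZ sp]]] := noetherian_ffun nV (koszul_cycle_submod i).
apply: (quot_basis_exists (koszul_boundary_submod i) eZ) => f /sp [b ->].
have /boolp.choice [c hc] := resk.
exists (fun j => c (b j)); rewrite -sumrB; apply: submod_sum => [|j _].
  exact: koszul_boundary_submod.
by rewrite -scalerBl; apply: koszul_boundary_ideal.
Qed.

End KoszulHomologyFinite.

Section HilbertBasis.
Variable n : nat.

(** Induction on the set [s] of exponents to be compared.  If [N] bounds exponent
    [i] in a finite family dominating on [s], then monomials with exponent at least
    [N] at [i] are dominated by that family, and each of the [N] remaining values
    of the exponent is treated separately. *)
Lemma dickson (s : seq 'I_n) (P : 'X_{1..n} -> Prop) :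
  exists ms : seq 'X_{1..n}, (forall m, m \in ms -> P m) /\
    forall m, P m -> exists2 m', m' \in ms & forall i, i \in s -> (m' i <= m i)%N.
Proof.
elim: s P => [|i s IH] P.
  have [[m Pm]|noP] := pselect (exists m, P m).
    exists [:: m]; split=> [m'|m' _]; first by rewrite inE => /eqP->.
    by exists m; rewrite ?inE.
  by exists [::]; split=> // m Pm; case: noP; exists m.
have [ms0 [P0 c0]] := IH P.
have /boolp.choice [F hF] := fun v : nat => IH (fun m => P m /\ m i = v).
pose N := (\max_(m <- ms0) (m : 'X_{1..n}) i)%N.
exists (ms0 ++ flatten [seq F v | v <- iota 0 N]); split.
  move=> m; rewrite mem_cat => /orP [/P0 //|/flattenP [_ /mapP [v _ ->] mF]].
  by have [/(_ m mF) []] := hF v.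
move=> m Pm; have [Nm|mN] := leqP N (m i).
  have [m' m'in m'm] := c0 m Pm; exists m'; first by rewrite mem_cat m'in.
  move=> j; rewrite inE => /orP [/eqP->|/m'm //].
  by apply: leq_trans Nm; exact: (@leq_bigmax_seq _ _ predT (fun m : 'X_{1..n} => m i)).
have [PF /(_ m (conj Pm erefl)) [m' m'in m'm]] := hF (m i).
exists m'.
  rewrite mem_cat; apply/orP; right; apply/flattenP; exists (F (m i)) => //.
  by apply: map_f; rewrite mem_iota.
move=> j; rewrite inE => /orP [/eqP->|/m'm //].
by have [_ ->] := PF m' m'in.
Qed.

(** Elements whose leading monomials dominate all leading monomials of [Q] generate
    [Q], by division with respect to the well-founded monomial order. *)
Lemma mpoly_noetherian (k : fieldType) : noetherian {mpoly k[n]}^o.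
Proof.
move=> Q sQ.
have [ms [Pms cms]] := dickson (enum 'I_n)
  (fun m => exists p : {mpoly k[n]}, [/\ Q p, p != 0 & mlead p = m]).
have /boolp.choice [g hg] : forall m, exists p : {mpoly k[n]},
    m \in ms -> [/\ Q p, p != 0 & mlead p = m].
  move=> m; have [mi|mi] := boolP (m \in ms); last by exists 0.
  by have [p hp] := Pms m mi; exists p.
apply: (@fgen_seq _ _ _ [seq (g m : {mpoly k[n]}^o) | m <- ms]).
  by move=> _ /mapP [m /hg [Qm _ _] ->].
move=> B sB hB p; elim/mleadrect: p => p IH Qp.
have [->|p0] := eqVneq p 0; first exact: sB.1.
have [|m mi le_m] := cms (mlead p); first by exists p.
have [Qg g0 lg] := hg m mi.
have {}le_m : (m <= mlead p)%MM by apply/mnm_lepP => i; apply: le_m; rewrite mem_enum.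
pose a := (p@_(mlead p) / (g m)@_m) *: 'X_[mlead p - m] : {mpoly k[n]}.
have gm0 : (g m)@_m != 0 by move: g0; rewrite -mleadc_eq0 lg.
have lp0 : p@_(mlead p) != 0 by rewrite mleadc_eq0.
have a0 : p@_(mlead p) / (g m)@_m != 0 by rewrite mulf_neq0 ?invr_eq0.
have la : mlead (a * g m) = mlead p.
  rewrite mleadM //; last by rewrite -mleadc_eq0 mleadcZE mleadXm mcoeffX eqxx mulr1.
  by rewrite mleadZ // mleadXm lg submK.
have ca : (a * g m)@_(mlead p) = p@_(mlead p).
  have E : (g m * 'X_[mlead p - m])@_(mlead p) = (g m)@_m.
    by rewrite -{1}(submK le_m) mcoeffMX.
  by rewrite /a -scalerAl mcoeffZ mulrC [_ * g m]mulrC E mulrC divfK.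
have Ba : B (a * g m) by exact: (submodZ sB a (hB _ (map_f g mi))).
rewrite -[p](subrK (a * g m)); apply: (submodD sB) => //.
have Qa : Q (p - a * g m).
  exact: (submodB sQ Qp (submodZ sQ a Qg)).
have [->|q0] := eqVneq (p - a * g m) 0; first exact: sB.1.
apply: IH => //; rewrite Order.POrderTheory.lt_neqAle; apply/andP; split.
  apply: contraNneq q0 => E; rewrite -mleadc_eq0 E mcoeffB ca subrr //.
by have := mleadB_le p (a * g m); rewrite la Order.JoinTheory.joinxx.
Qed.

End HilbertBasis.

(** * A criterion for Golod modules *)

Section GolodCriterion.
Variables (k : fieldType) (R : comNzRingType) (iota : {rmorphism k -> R}).
Variables (n : nat) (y : 'I_n -> R).
Hypothesis residue : forall x, exists c, var_ideal y (x - iota c).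
Hypothesis proper : forall c, var_ideal y (iota c) -> c = 0.
Hypothesis noethR : noetherian R^o.

Local Notation cycleR := (koszul_cycle (V := R^o) y).
Local Notation boundaryR := (koszul_boundary (V := R^o) y).

Lemma koszul_basis0 : has_quot_basis iota (cycleR 0) (boundaryR 0) 'I_1.
Proof.
have cyc1 : cycleR 0 (unit_chain n (1 : R^o)).
  by split; [exact: unit_chain_deg | apply: koszul_deg0_diff; exact: unit_chain_deg].
exists (fun=> unit_chain n (1 : R^o)); split=> // [f [df _]|c].
  have [c hc] := residue (f set0); exists (fun=> c).
  rewrite big_ord1 (koszul_deg0E df).
  have -> : unit_chain n (f set0) = (f set0 : R) *: unit_chain n (1 : R^o).
    by rewrite -linearZ /=; congr unit_chain; rewrite -[LHS]mulr1.
  by rewrite -scalerBl; apply: koszul_boundary_ideal.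
rewrite big_ord1 => -[g dg /ffunP/(_ set0)]; rewrite !ffunE eqxx => E t.
rewrite (ord1 t); apply: proper; apply/var_idealP.
exists (fun j => g (j |: set0)); rewrite -[iota _]mulr1.
rewrite -[_ * 1]/((iota (c ord0)) *: (1 : R^o)) E.
apply: eq_big => [j|j _]; first by rewrite inE.
rewrite (_ : [set l in _ | _] = set0) ?cards0 ?expr0 ?mul1r; first exact: mulrC.
by apply/setP=> l; rewrite !inE.
Qed.

Lemma koszul_deg_gt (V : lmodType R) i (f : {ffun {set 'I_n} -> V}) :
  (n < i)%N -> koszul_deg i f -> f = 0.
Proof.
move=> ni df; apply/ffunP=> J; rewrite ffunE df //.
by have := max_card (mem J); rewrite card_ord; move: #|_| => c; lia.
Qed.

(** [P] plays the part of the derivative ideal modulo [I]. *)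
Variables (P : R -> Prop) (M : lmodType R).
Hypothesis cyclesP : forall i f, (0 < i)%N -> cycleR i f ->
  exists g : {ffun {set 'I_n} -> R^o},
    [/\ forall A, P (g A), cycleR i g & boundaryR i (f - g)].
Hypothesis P_sq0 : forall x x', P x -> P x' -> x * x' = 0.
Hypothesis P_kill : forall x (m : M), P x -> x *: m = 0.
Hypothesis fgM : finitely_generated M.

(** The hypotheses on [P] make all Massey operations, on the ring and on [M],
    trivially zero.  The letters are a basis of [H_(j.+1)(K)], [j < n], which is all of
    the homology in positive degree. *)
Theorem golod_criterion : exists (F : free_resolution M) (p kM kR : nat -> nat),
  [/\ forall i, has_quot_basis iota (@tor_cycles _ _ y M F i)
        (@tor_boundaries _ _ y M F i) 'I_(p i),
      forall i, has_quot_basis iota (koszul_cycle (V := M) y i)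
        (koszul_boundary (V := M) y i) 'I_(kM i),
      forall i, has_quot_basis iota (cycleR i) (boundaryR i) 'I_(kR i)
    & forall i, series_mul (fun j => (p j)%:Z) (golod_denominator kR) i = (kM i)%:Z].
Proof.
have [F] := free_resolution_exists noethR fgM; exists F.
have /boolp.choice [kM hkM] := fun i =>
  koszul_basis_exists i residue (noetherian_fg noethR fgM).
have /boolp.choice [kR1 hkR1] := fun i => koszul_basis_exists i residue noethR.
have exE (j : 'I_n) : exists e : 'I_(kR1 j.+1) -> {ffun {set 'I_n} -> R^o},
    quot_basis iota (cycleR j.+1) (boundaryR j.+1) e /\ forall t A, P (e t A).
  have [||e he eP] := quot_basis_adjust
    (P := fun g : {ffun {set 'I_n} -> R^o} => forall A, P (g A)) _ _ (hkR1 j.+1).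
  - exact: koszul_boundary_submod.
  - by move=> f /(cyclesP (ltn0Sn j)).
  - by exists e.
pose L := {j : 'I_n & 'I_(kR1 j.+1)}.
pose tg (j : 'I_n) (t : 'I_(kR1 j.+1)) : L := Tagged (fun i : 'I_n => 'I_(kR1 i.+1)) t.
pose deg (l : L) := (tag l).+1.
pose z (l : L) : {ffun {set 'I_n} -> R^o} := sval (cid (exE (tag l))) (tagged l).
have hz (j : 'I_n) : quot_basis iota (cycleR j.+1) (boundaryR j.+1)
    (fun t : 'I_(kR1 j.+1) => z (tg _ t)).
  exact: (svalP (cid (exE j))).1.
have zP l A : P (z l A) by exact: (svalP (cid (exE (tag l)))).2.
have z_deg l : koszul_deg (deg l) (z l).
  by case: l => j t; have [Z _ _] := hz j; have [] := Z t.
have z_cycle l : koszul_diff y (z l) = 0.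
  by case: l => j t; have [Z _ _] := hz j; have [] := Z t.
have sumL (G : zmodType) (f : L -> G) (j : 'I_n) : \sum_(l | deg l == j.+1) f l =
    \sum_(t : 'I_(kR1 j.+1)) f (tg _ t).
  transitivity (\sum_(i | i == j) \sum_(t : 'I_(kR1 i.+1)) f (tg _ t)).
    rewrite sig_big_dep /=; apply: eq_big => [[i t]|[i t] _] //=.
    by rewrite eqSS andbT.
  by rewrite big_pred1_eq.
have mulE l (u : R^o) : mulr_chain (z l) (unit_chain n u) = (u : R) *: z l.
  by apply/ffunP=> A; rewrite mulr_unit_chain ffunE; apply: mulrC.
have z_span : koszul_spanned y deg z R^o.
  move=> i f; have [ni _ df _|] := ltnP n i.
    exists 0, (fun=> 0); split; first by move=> J _; rewrite ffunE.
    by rewrite (koszul_deg_gt ni df) linear0 big1 ?addr0 // => l _; rewrite !linear0.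
  case: i => // i ni _ df cf; have [_ sp _] := hz (Ordinal ni).
  have [|c [g dg hg]] := sp f; first by split.
  exists g; exists (fun l : L => if insub (val (tagged l)) is Some t
     then iota (c t) else 0); split=> //.
  rewrite -hg (sumL _ _ (Ordinal ni)) -[LHS](subrK (\sum_t iota (c t) *: z (tg _ t))).
  congr (_ + _); apply: eq_bigr => t _; rewrite mulE /=.
  by case: insubP => [t' _ /val_inj ->|]; rewrite ?ltn_ord.
have z_ind : koszul_independent y deg z R^o.
  move=> i g u i0 dg hg l li.
  have /boolp.choice [c hc] := fun l => residue (u l).
  suff cl : c l = 0.
    have := hc l; rewrite cl rmorph0 subr0 => /var_idealP [b hb]; exists b.
    by rewrite hb; apply: eq_bigr => j _; apply: mulrC.
  case: l li => j t ji; have [Z _ ind] := hz j.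
  apply: (ind (fun t => c (tg j t))).
  have bdg : boundaryR j.+1 (\sum_t (u (tg j t) : R) *: z (tg j t)).
    exists g; first by move: dg; rewrite -ji.
    rewrite -hg -ji (sumL _ _ j); apply: eq_bigr => t' _.
    by rewrite mulE.
  have sB := @koszul_boundary_submod R n y R^o j.+1.
  have D : boundaryR j.+1 (\sum_t (u (tg j t) - iota (c (tg j t))) *: z (tg j t)).
    by apply: submod_sum => // t' _; apply: koszul_boundary_ideal => //; apply: hc.
  have := submodB sB bdg D; rewrite -sumrB; congr (boundaryR _ _).
  by apply: eq_bigr => t' _; rewrite -scalerBl subKr.
have z_mul l l' A B : (z l A : R) * z l' B = 0 by apply: P_sq0.
have z_kill l A (x : M) : (z l A : R) *: x = 0 by apply: P_kill.
pose kR i := if i is j.+1 then if (j < n)%N then kR1 i else 0%N else 1%N.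
exists (golod_coef deg kM), kM, kR; split=> // [i|[|i]|i].
- have [T <- hT] := twisted_basis (iota := iota) z_deg z_kill i hkM.
  apply: has_quot_basis_card.
  exact: (tor_basis (iota := iota) (fun l => ltn0Sn _) z_deg z_cycle z_mul z_span z_ind F hT).
- exact: koszul_basis0.
- rewrite /kR; case: ltnP => // ni; exists (fun=> 0); split=> [[]//|f [df _]|c _ []//].
  exists (fun=> 0); rewrite big_ord0 subr0 (koszul_deg_gt _ df) //.
  exact: (@koszul_boundary_submod R n y R^o i.+1).1.
- apply: golod_coef_series => // -[//|m] _ /=.
  rewrite -sum1_card; case: ltnP => mn; last first.
    rewrite big1 // => l; rewrite inE /deg => /eqP [E].
    by have := ltn_ord (tag l); rewrite E ltnNge mn.
  apply/eqP; rewrite -eqz_nat (big_morph Posz PoszD (erefl (Posz 0))).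
  by rewrite (sumL _ _ (Ordinal mn)) sumr_const card_ord /= natz.
Qed.

End GolodCriterion.

(** * The Lie derivative along the Euler vector field *)

Section GeneratedIdeals.
Variable R : comNzRingType.

Lemma gen_ideal_submod (G : R -> Prop) :
  submod (gen_ideal G : R^o -> Prop).
Proof.
split=> [|a u v [r1 [c1 [g1 [G1 ->]]]] [r2 [c2 [g2 [G2 ->]]]]].
  by exists 0%N, (fun=> 0), (fun=> 0); split=> [[]//|]; rewrite big_ord0.
pose pick (T : Type) (f1 : 'I_r1 -> T) (f2 : 'I_r2 -> T) (i : 'I_(r1 + r2)) :=
  match fintype.split i with inl j => f1 j | inr j => f2 j end.
exists (r1 + r2)%N, (pick _ (fun i => a * c1 i) c2), (pick _ g1 g2).
split=> [i|]; first by rewrite /pick; case: fintype.split.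
rewrite big_split_ord /=; congr (_ + _).
  rewrite -[LHS]/(a * _) mulr_sumr; apply: eq_bigr => i _.
  by rewrite /pick (unsplitK (inl i : 'I_r1 + 'I_r2)) mulrA.
by apply: eq_bigr => i _; rewrite /pick (unsplitK (inr i : 'I_r1 + 'I_r2)).
Qed.

End GeneratedIdeals.

Section LieDerivative.
Variables (k : fieldType) (n : nat) (a : 'I_n -> nat).
Local Notation S := {mpoly k[n]}.
Local Notation K := {ffun {set 'I_n} -> S^o}.
Local Notation X := (fun i : 'I_n => ('X_i : S)).

Section WeightScaling.
Variable phi : nat -> k.

Definition wscale (p : S) : S :=
  \sum_(m <- msupp p) (phi (wdeg a m) * p@_m) *: 'X_[m].

Lemma mcoeff_wscale p m : (wscale p)@_m = phi (wdeg a m) * p@_m.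
Proof.
rewrite /wscale raddf_sum /=.
have [mp|mp] := boolP (m \in msupp p); last first.
  rewrite (memN_msupp_eq0 mp) mulr0 big_seq big1 // => m' m'p.
  rewrite mcoeffZ mcoeffX; case: eqP => [mm|_]; last by rewrite mulr0.
  by rewrite -mm m'p in mp.
rewrite (bigD1_seq m) ?msupp_uniq //= mcoeffZ mcoeffX eqxx mulr1.
rewrite big1 ?addr0 // => m' /negPf mm.
by rewrite mcoeffZ mcoeffX mm mulr0.
Qed.

Lemma wscale_is_linear : linear wscale.
Proof.
move=> c p q; apply/mpolyP=> m.
by rewrite mcoeffD mcoeffZ !mcoeff_wscale mcoeffD mcoeffZ mulrDr mulrCA.
Qed.
HB.instance Definition _ := GRing.isLinear.Build k S S _ wscale wscale_is_linear.

Lemma wscaleX m : wscale 'X_[m] = phi (wdeg a m) *: 'X_[m].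
Proof. by rewrite /wscale msuppX big_seq1 mcoeffX eqxx mulr1. Qed.

Lemma wscale_ideal (I : idealr S) p :
  homogeneous_ideal a I -> p \in I -> wscale p \in I.
Proof.
move=> hI Ip; rewrite (pihomog_partitionE (leqnn (mmeasure (wdeg a) p))).
rewrite linear_sum; apply: rpred_sum => d _ /=.
have -> : wscale (pihomog (wdeg a) d p) = phi d *: pihomog (wdeg a) d p.
  apply/mpolyP=> m; rewrite mcoeff_wscale mcoeffZ.
  have [mp|mp] := boolP (m \in msupp (pihomog (wdeg a) d p)); last first.
    by rewrite (memN_msupp_eq0 mp) !mulr0.
  by have /dhomogP/(_ m mp) /= -> := pihomogP (wdeg a) d p.
by rewrite -mul_mpolyC; apply: idealMr; apply: hI.
Qed.

End WeightScaling.

Lemma wdegU i : wdeg a U_(i)%MM = a i.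
Proof.
rewrite /wdeg (bigD1 i) //= mnm1E eqxx mul1n big1 ?addn0 // => j /negPf ji.
by rewrite mnm1E eq_sym ji.
Qed.

Lemma wscaleXM phi i p :
  wscale phi ('X_i * p) = 'X_i * wscale (fun d => phi (a i + d)%N) p.
Proof.
rewrite [p]mpolyE mulr_sumr !linear_sum mulr_sumr; apply: eq_bigr => m _.
rewrite -scalerAr !linearZ /= -scalerAr -mpolyXD !wscaleX wdegD wdegU.
by rewrite -scalerAr mpolyXD.
Qed.

Definition Euler (p : S) : S := \sum_i (a i)%:R *: ('X_i * p^`M(i)).

Lemma Euler_is_linear : linear Euler.
Proof.
move=> c p q; rewrite /Euler scaler_sumr -big_split; apply: eq_bigr => i _ /=.
by rewrite linearP mulrDr -scalerAr scalerDr !scalerA mulrC.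
Qed.
HB.instance Definition _ := GRing.isLinear.Build k S S _ Euler Euler_is_linear.

Lemma EulerX m : Euler 'X_[m] = (wdeg a m)%:R *: 'X_[m].
Proof. by apply: euler_formula; apply/dhomogP => m' /mem_msuppXP <-. Qed.

Lemma Euler_wscale phi b p :
  (forall d, phi d * (d + b)%:R = 1) ->
  Euler (wscale phi p) + b%:R *: wscale phi p = p.
Proof.
move=> hphi; rewrite [RHS](mpolyE p) /wscale linear_sum scaler_sumr.
rewrite -big_split /=; apply: eq_bigr => m _.
rewrite linearZ /= EulerX !scalerA -scalerDl [b%:R * _]mulrC -mulrDr -natrD.
by rewrite mulrAC hphi mul1r.
Qed.

Definition set_weight (J : {set 'I_n}) := (\sum_(j in J) a j)%N.

(** Inverse of the Lie derivative; the weight of [e_J] is that of the monomial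
    with exponents 1 on [J]. *)
Definition inv_weight (f : K) : K :=
  [ffun J => wscale (fun d => (d + set_weight J)%:R^-1) (f J)].

Lemma inv_weight_deg i f : koszul_deg i f -> koszul_deg i (inv_weight f).
Proof. by move=> df J Ji; rewrite ffunE df ?linear0. Qed.


Lemma inv_weight_diff f :
  koszul_diff X (inv_weight f) = inv_weight (koszul_diff X f).
Proof.
apply/ffunP=> J; rewrite !ffunE linear_sum; apply: eq_bigr => j jJ.
have scaleE (u v : S) : u *: (v : S^o) = u * v by [].
rewrite ffunE !scaleE.
have -> : (-1) ^+ #|[set l in J | (l < j)%N]| =
    ((-1) ^+ #|[set l in J | (l < j)%N]|)%:MP :> S.
  by rewrite rmorphXn rmorphN1.
rewrite -!mulrA !mul_mpolyC linearZ /= wscaleXM.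
suff -> : (fun d => (d + set_weight (j |: J))%:R^-1) =
    (fun d => (a j + d + set_weight J)%:R^-1) :> (nat -> k) by [].
apply/funext => d; congr (_%:R^-1); rewrite /set_weight (big_setU1 _ jJ) /=.
by rewrite addnCA addnA.
Qed.

Definition dpart i (f : K) : K := [ffun J => (f J)^`M(i)].

Lemma dpart_wedge_sign i (m : nat) (p : S) :
  ((-1) ^+ m * p)^`M(i) = (-1) ^+ m * p^`M(i).
Proof.
have -> : (-1) ^+ m = ((-1) ^+ m)%:MP :> S by rewrite rmorphXn rmorphN1.
by rewrite !mul_mpolyC linearZ.
Qed.

Lemma dpart_diff i f :
  dpart i (koszul_diff X f) = koszul_diff X (dpart i f) + contract i f.
Proof.
apply/ffunP=> J; rewrite !ffunE linear_sum /=.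
transitivity (\sum_(j | j \notin J)
   ((((-1) ^+ #|[set l in J | (l < j)%N]| * 'X_j) *: (dpart i f (j |: J)) : S) +
   (if j == i then (-1) ^+ #|[set l in J | (l < j)%N]| *: f (j |: J) else 0))).
  apply: eq_bigr => j _; rewrite -[X in X^`M(i)]/((_ * _) * _) -mulrA.
  rewrite dpart_wedge_sign mderivM mulrDr addrC ffunE.
  congr (_ + _); first exact: mulrA.
  rewrite mderivX mnm1E; case: eqVneq => [->|_]; last by rewrite scale0r mul0r mulr0.
  rewrite (_ : (U_(i) - U_(i))%MM = 0%MM) ?mpolyX0 ?scale1r ?mul1r //.
  by apply/mnmP=> l; rewrite mnmBE subnn mnm0E.
rewrite big_split /=; congr (_ + _); rewrite -big_mkcondr /=.
have [iJ|iJ] := boolP (i \in J).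
  by rewrite big1 // => j /andP[jJ /eqP ji]; rewrite ji iJ in jJ.
rewrite (big_pred1 i) // => j /=; case: eqVneq => [->|]; last by rewrite andbF.
by rewrite iJ.
Qed.

(** The de Rham differential, with [e_j] standing for [dX_j / a_j] so that the
    Koszul differential is contraction with the Euler vector field. *)
Definition de_rham (f : K) : K := \sum_j ((a j)%:R : S) *: wedge j (dpart j f).

Lemma de_rham_deg i f : koszul_deg i f -> koszul_deg i.+1 (de_rham f).
Proof.
move=> df J Ji; rewrite sum_ffunE big1 // => j _; rewrite ffunE.
rewrite (@koszul_deg_wedge _ _ _ i) ?scaler0 // => A Ai.
by rewrite ffunE df ?linear0.
Qed.

(** Cartan's formula.  Only the commutator of [X_i] with the derivation [i] and the
    Clifford relation survive, producing the weight of the coefficient and that of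
    [e_J]. *)
Lemma cartan f J :
  (koszul_diff X (de_rham f) + de_rham (koszul_diff X f)) J =
  Euler (f J) + (set_weight J)%:R *: (f J : S) :> S.
Proof.
rewrite linear_sum -big_split /= sum_ffunE.
transitivity (\sum_j ((a j)%:R *: ('X_j * (f J)^`M(j)) +
    (if j \in J then (a j)%:R *: (f J : S) else 0) : S)); last first.
  rewrite big_split /=; congr (_ + _); rewrite -big_mkcond /= -scaler_suml.
  by rewrite natr_sum.
apply: eq_bigr => j _; rewrite linearZ /= -scalerDr koszul_diff_wedge dpart_diff.
rewrite [wedge j (_ + _)]linearD addrA subrK !ffunE; case: ifP => jJ.
  rewrite !inE eqxx /= preds_setD1_id scalerA -expr2 sqrr_sign scale1r.
  rewrite setD1K // scalerDr; congr (_ + _).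
    by rewrite -[LHS]/(_ * (_ * _)) -[RHS]mul_mpolyC rmorph_nat.
  by rewrite -[LHS]/(_ * _) -[RHS]mul_mpolyC rmorph_nat.
by rewrite !addr0 -[LHS]/(_ * (_ * _)) -[RHS]mul_mpolyC rmorph_nat.
Qed.

Hypothesis char0 : [pchar k] =i pred0.
Hypothesis a_gt0 : forall i, (0 < a i)%N.

(** In degree [i > 0] every [J] is nonempty, so all weights are positive. *)
Lemma chain_homotopic_to_derivatives i f : (0 < i)%N -> koszul_deg i f ->
  f = koszul_diff X (de_rham (inv_weight f)) + de_rham (inv_weight (koszul_diff X f)).
Proof.
move=> i0 df; rewrite -inv_weight_diff; apply/ffunP=> J; rewrite cartan ffunE.
have [Ji|Ji] := eqVneq #|J| i; last by rewrite df // !linear0 addr0.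
rewrite Euler_wscale // => d; rewrite mulVf // ((pcharf0P k).1 char0).
rewrite addn_eq0 negb_and orbC; apply/orP; left.
have /card_gt0P [j jJ] : (0 < #|J|)%N by rewrite Ji.
by rewrite /set_weight (bigD1 j) //= addn_eq0 negb_and -lt0n a_gt0.
Qed.

Lemma de_rham_ideal (I : idealr S) (f : K) :
  (forall J, f J \in I) -> forall J, deriv_ideal I (de_rham f J).
Proof.
move=> fI J; rewrite sum_ffunE.
apply: (submod_sum (gen_ideal_submod _)) => j _.
rewrite ffunE; apply: (submodZ (gen_ideal_submod _)); rewrite !ffunE.
case: ifP => _; last exact: (submod0 (gen_ideal_submod _)).
apply: (submodZ (gen_ideal_submod _)).
by apply: gen_ideal_in; exists (f (J :\ j)), j.
Qed.

End LieDerivative.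

(** * Ideals whose derivative ideal squares into them *)

Local Open Scope quotient_scope.

Section Assembly.
Variables (k : fieldType) (n : nat) (a : 'I_n -> nat).
Local Notation S := {mpoly k[n]}.
Variable I : idealr S.
Local Notation R := {ideal_quot I}.

Definition quot_pi : {rmorphism S -> R} := \pi_R.
Definition quot_const : {rmorphism k -> R} := (quot_pi \o @mpolyC n k)%FUN.
Local Notation y := (fun i : 'I_n => quot_pi 'X_i).

Lemma quot_pi_eq0 p : quot_pi p = 0 <-> p \in I.
Proof.
rewrite -{2}[p]subr0 Quotient.idealrBE -(rmorph0 quot_pi); split=> /eqP //.
Qed.

Lemma quot_pi_surj x : exists p, quot_pi p = x.
Proof. by exists (repr x); apply: reprK. Qed.

Lemma has_kdim_quot_basis (V : lmodType R) (Z B : V -> Prop) d : submod B ->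
  has_quot_basis quot_const Z B 'I_d -> has_kdim Z B d.
Proof.
move=> sB [e [eZ sp ind]]; exists e; split=> // z /sp [c Bc].
exists (\row_j c j); split=> [|c' Bc'].
  by under eq_bigr => j _ do rewrite mxE.
apply/rowP => j; rewrite mxE; apply/eqP; rewrite -subr_eq0; apply/eqP.
apply: (ind (fun j => c j - c' 0 j)).
have := submodB sB Bc' Bc; rewrite opprB addrC addrA subrK.
rewrite -sumrB; congr B; apply: eq_bigr => l _.
by rewrite rmorphB scalerBl.
Qed.

Lemma mcoeff_mulX (p : S) (j : 'I_n) (m : 'X_{1..n}) : m j = 0%N -> (p * 'X_j)@_m = 0.
Proof.
move=> mj; apply: memN_msupp_eq0; rewrite (perm_mem (msuppMX p U_(j))).
apply/mapP => -[m' _ /mnmP/(_ j)].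
by rewrite mj mnmDE mnm1E eqxx.
Qed.

Lemma var_ideal_submod (A : comNzRingType) (x : 'I_n -> A) :
  submod (var_ideal x : A^o -> Prop).
Proof. exact: gen_ideal_submod. Qed.

Lemma var_ideal_const (p : S) : var_ideal (fun i : 'I_n => 'X_i : S) (p - (p@_0)%:MP).
Proof.
pose Q := var_ideal (fun i : 'I_n => 'X_i : S).
suff -> : p - (p@_0)%:MP =
    \sum_(m <- msupp p) (p@_m)%:MP * ('X_[m] - ('X_[m]@_0)%:MP).
  apply: (submod_sum (@var_ideal_submod S _)) => m _.
  apply: (@submodZ _ S^o _ (@var_ideal_submod S _)).
  have [->|m0] := eqVneq m 0%MM.
    by rewrite mcoeffX eqxx mpolyX0 /= mpolyC1 subrr; apply: (submod0 (@var_ideal_submod S _)).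
  have [i mi] : exists i, m i != 0%N.
    by apply/existsP; apply: contraNT m0 => /existsPn h; apply/eqP/mnmP => i;
      rewrite mnm0E; apply/eqP; have := h i; rewrite negbK.
  rewrite mcoeffX (negPf m0) subr0 -(submK (m := U_(i)) (m' := m)) ?lep1mP //.
  rewrite mpolyXD; apply: (@submodZ _ S^o _ (@var_ideal_submod S _)).
  by apply: gen_ideal_in; exists i.
under eq_bigr => m _ do rewrite mulrBr -mpolyCM mul_mpolyC.
rewrite big_split sumrN /= -mpolyE; congr (_ - _).
rewrite -rmorph_sum /=; congr (_%:MP); rewrite {1}(mpolyE p) raddf_sum.
by apply: eq_bigr => m _; rewrite /= mcoeffZ.
Qed.

Lemma quot_residue x : exists c, var_ideal y (x - quot_const c).
Proof.
have [p <-] := quot_pi_surj x; exists p@_0.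
rewrite -[quot_const _]/(quot_pi (p@_0)%:MP) -rmorphB.
have /var_idealP [c ->] := var_ideal_const p.
apply/var_idealP; exists (fun j => quot_pi (c j)).
by rewrite rmorph_sum; apply: eq_bigr => j _; rewrite rmorphM.
Qed.

Lemma quot_noetherian : noetherian R^o.
Proof. exact: noetherian_quotient quot_pi_surj (mpoly_noetherian (n := n) (k := k)). Qed.

Hypothesis char0 : [pchar k] =i pred0.
Hypothesis a_gt0 : forall i, (0 < a i)%N.
Hypothesis hI : homogeneous_ideal a I.

Lemma wdeg_eq0 m : (wdeg a m == 0%N) = (m == 0%MM).
Proof.
apply/eqP/eqP => [|->]; last exact: wdeg0.
move/eqP; rewrite /wdeg sum_nat_eq0 => /forallP w0.
apply/mnmP => i; rewrite mnm0E; apply/eqP.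
by move: (w0 i); rewrite muln_eq0 [a i == 0%N]gtn_eqF ?orbF ?a_gt0.
Qed.

Lemma mcoeff_pihomog d (p : S) m :
  (pihomog (wdeg a) d p)@_m = (wdeg a m == d)%:R * p@_m.
Proof.
have -> : pihomog (wdeg a) d p = wscale a (fun e => (e == d)%:R) p.
  rewrite /wscale pihomogE big_mkcond /=; apply: eq_bigr => m' _.
  by case: eqP => _; rewrite ?mul1r // mul0r scale0r.
by rewrite mcoeff_wscale.
Qed.

Lemma ideal_const0 p : p \in I -> p@_0 = 0.
Proof.
move=> Ip; apply/eqP/negPn/negP => c0.
have := hI 0 Ip.
have -> : pihomog (wdeg a) 0 p = (p@_0)%:MP.
  apply/mpolyP => m; rewrite mcoeff_pihomog wdeg_eq0 mcoeffC eq_sym.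
  by case: eqVneq => [<-|_]; rewrite ?mul1r ?mulr1 // mul0r mulr0.
move=> /(idealMr ((p@_0)^-1)%:MP); rewrite -mpolyCM mulVf // mpolyC1.
by rewrite idealr1.
Qed.

Lemma quot_proper c : var_ideal y (quot_const c) -> c = 0.
Proof.
move=> /var_idealP [b].
rewrite -[quot_const _]/(quot_pi c%:MP) => E.
have : c%:MP - \sum_j repr (b j) * 'X_j \in I.
  apply/quot_pi_eq0; rewrite rmorphB rmorph_sum E -sumrB big1 // => j _.
  by rewrite rmorphM -[quot_pi (repr _)]/(\pi_R (repr _)) reprK subrr.
move=> /ideal_const0; rewrite mcoeffB mcoeffC eqxx mulr1 raddf_sum /= big1 ?subr0 //.
by move=> j _; rewrite mcoeff_mulX // mnm0E.
Qed.

Hypothesis deriv_proper : ~ deriv_ideal I 1.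

(** In the component of weight [a i], the derivative along [X_i] has weight 0: it is
    the constant coefficient of [X_i]. *)
Lemma ideal_linear0 p i : p \in I -> p@_U_(i) = 0.
Proof.
move=> Ip; apply/eqP/negPn/negP => c0; apply: deriv_proper.
have qI := hI (a i) Ip; set q := pihomog _ _ p in qI.
have dq : q^`M(i) = (p@_U_(i))%:MP.
  apply/mpolyP => m; rewrite mcoeff_deriv mcoeff_pihomog wdegD wdegU mcoeffC.
  rewrite -[X in _ == X]add0n eqn_add2r wdeg_eq0 eq_sym.
  case: eqVneq => [<-|_]; last by rewrite mul0r mul0rn mulr0.
  by rewrite add0m mnm0E mul1r mulr1.
have -> : 1 = ((p@_U_(i))^-1)%:MP * q^`M(i) by rewrite dq -mpolyCM mulVf.
apply: (@submodZ _ S^o _ (gen_ideal_submod _)).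
by apply: gen_ideal_in; exists q, i.
Qed.

(** Dropping [X_i] would put into [I] a polynomial with linear coefficient 1 at
    [X_i]. *)
Lemma variables_minimal : minimal_homogeneous_generators a y.
Proof.
split=> [j|x|J hJ].
- exists (a j), 'X_j; split=> //; apply/dhomogP => m.
  by rewrite msuppX inE => /eqP->; apply: wdegU.
- by [].
apply/setP => i; rewrite inE; apply/negPn/negP => iJ.
have : max_ideal (quot_pi 'X_i : R) by apply: gen_ideal_in; exists i.
move=> /hJ [r [c [g [gJ E]]]].
have /boolp.choice [s hs] : forall l, exists j, j \in J /\ g l = y j.
  by move=> l; have [j] := gJ l; exists j.
have : 'X_i - \sum_l repr (c l) * 'X_(s l) \in I.
  apply/quot_pi_eq0; rewrite rmorphB rmorph_sum E -sumrB big1 // => l _.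
  by rewrite rmorphM -[quot_pi (repr _)]/(\pi_R (repr _)) reprK (hs l).2 subrr.
move=> /ideal_linear0 - /(_ i); rewrite mcoeffB mcoeffX eqxx raddf_sum /= big1.
  by rewrite subr0 => /eqP; rewrite oner_eq0.
move=> l _; rewrite mcoeff_mulX // mnm1E; case: eqP => // il.
by move: iJ; rewrite il (hs l).1.
Qed.

Definition deriv_classes (x : R) := exists2 p, deriv_ideal I p & x = quot_pi p.

Definition chain_pi (f : {ffun {set 'I_n} -> S^o}) : {ffun {set 'I_n} -> R^o} :=
  [ffun J => quot_pi (f J)].

Lemma chain_pi_diff f :
  chain_pi (koszul_diff (fun i : 'I_n => 'X_i : S) f) = koszul_diff y (chain_pi f).
Proof.
apply/ffunP => J; rewrite !ffunE rmorph_sum; apply: eq_bigr => j _.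
by rewrite ffunE !rmorphM rmorphXn rmorphN1.
Qed.

(** The homotopy [chain_homotopic_to_derivatives], applied to a lift of [f] to [S]
    and reduced modulo [I]. *)
Lemma koszul_cycle_deriv i (f : {ffun {set 'I_n} -> R^o}) :
  (0 < i)%N -> koszul_cycle y i f ->
  exists g : {ffun {set 'I_n} -> R^o}, [/\ forall A, deriv_classes (g A),
    koszul_cycle y i g & koszul_boundary y i (f - g)].
Proof.
move=> i0 [df cf].
pose F : {ffun {set 'I_n} -> S^o} :=
  [ffun J : {set 'I_n} => if #|J| == i then repr (f J) else 0].
have dF : koszul_deg i F by move=> J /negPf Ji; rewrite ffunE Ji.
have piF : chain_pi F = f.
  apply/ffunP => J; rewrite !ffunE; case: eqP => [_|/eqP Ji]; first exact: reprK.
  by rewrite rmorph0 df.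
pose X := fun i : 'I_n => 'X_i : S.
pose W := de_rham a (inv_weight a (koszul_diff X F)).
pose G := de_rham a (inv_weight a F).
have FE : F = koszul_diff X G + W by apply: (chain_homotopic_to_derivatives char0 a_gt0 i0 dF).
have fE : f - chain_pi W = koszul_diff y (chain_pi G).
  rewrite -chain_pi_diff; apply/ffunP => J.
  have FJ : F J = koszul_diff X G J + W J by rewrite {1}FE ffunE.
  transitivity (quot_pi (F J) - quot_pi (W J)); first by rewrite -{1}piF !ffunE.
  by rewrite FJ rmorphD addrK [RHS]ffunE.
have dG : koszul_deg i.+1 (chain_pi G).
  move=> J Ji; rewrite ffunE.
  by rewrite (de_rham_deg a (inv_weight_deg a dF)) ?rmorph0.
exists (chain_pi W); split; last by exists (chain_pi G).
- move=> A; rewrite ffunE; exists (W A) => //; apply: de_rham_ideal => J.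
  rewrite ffunE; apply: wscale_ideal => //; apply/quot_pi_eq0.
  have /ffunP/(_ J) := chain_pi_diff F.
  by rewrite piF cf !ffunE.
have -> : chain_pi W = f - koszul_diff y (chain_pi G) by rewrite -fE subKr.
by apply: (submodB (@koszul_cycle_submod R n y R^o i)); split=> //;
  [apply: koszul_deg_diff|rewrite koszul_diff_diff].
Qed.

Lemma tor_boundary_submod (M : lmodType R) (F : free_resolution M) i :
  submod (@tor_boundary k n I M F i).
Proof.
split=> [|c u v [w hw] [w' hw']].
  exists 0 => l; rewrite mul0mx subrr mxE.
  exact: (submod0 (@var_ideal_submod R y)).
exists (c *: w + w') => l.
have -> : (c *: u + v - (c *: w + w') *m diff F i) 0 l =
    c * (u - w *m diff F i) 0 l + (v - w' *m diff F i) 0 l.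
  by rewrite mulmxDl -scalemxAl !mxE mulrBr opprD addrACA.
apply: (submodD (@var_ideal_submod R y)); last exact: hw'.
exact: (submodZ (@var_ideal_submod R y) c (hw l)).
Qed.

End Assembly.

Theorem theorem3p5 (k : fieldType) (n : nat) (a : 'I_n -> nat)
    (M : lmodType {mpoly k[n]}) (gr : int -> M -> Prop)
    (I : idealr {mpoly k[n]})
    (hchar : [pchar k] =i pred0)
    (ha : forall i, (0 < a i)%N)
    (hgr : is_grading a gr)
    (hfg : finitely_generated M)
    (hnz : exists x : M, x != 0)
    (hI : homogeneous_ideal a I)
    (hI2 : forall p, prod_ideal (deriv_ideal I) (deriv_ideal I) p -> p \in I)
    (hann : forall p, deriv_ideal I p -> annihilates M p) :
  golod_module a (quot_mod (ideal_annihilates hchar ha hI hann)).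
Proof.
have deriv_kill p (x : M) : deriv_ideal I p -> p *: x = 0 by move=> dp; exact: hann.
have deriv_proper : ~ deriv_ideal I 1.
  by move=> I1; have [x /eqP[]] := hnz; rewrite -[x]scale1r deriv_kill.
set h := ideal_annihilates hchar ha hI hann.
have scaleE (p : {mpoly k[n]}) (x : quot_mod h) :
  quot_pi I p *: x = p *: (x : M) :> M := quot_scaleE p x.
have sq0 x x' : deriv_classes x -> deriv_classes x' -> x * x' = 0 :> {ideal_quot I}.
  move=> [p dp ->] [q dq ->]; rewrite -rmorphM; apply/quot_pi_eq0; apply: hI2.
  by apply: gen_ideal_in; exists p, q.
have kill (x : {ideal_quot I}) (m : quot_mod h) : deriv_classes x -> x *: m = 0.
  by move=> [p dp ->]; rewrite scaleE; apply: deriv_kill.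
have fg : finitely_generated (quot_mod h).
  have [r [e he]] := hfg; exists r, e => m; have [c mE] := he m.
  exists (fun i => quot_pi I (c i)); rewrite [LHS]mE.
  by apply: eq_bigr => i _; rewrite -[LHS](scaleE (c i) (e i)).
have [F [p [kM [kR [hp hM hR hser]]]]] :=
  golod_criterion (@quot_residue k n I) (quot_proper ha hI) (@quot_noetherian k n I)
    (koszul_cycle_deriv hchar ha hI) sq0 kill fg.
exists n, (fun i => quot_pi I 'X_i); split; first exact: variables_minimal.
exists p, kM, kR; split=> //.
- exists F => i; apply: has_kdim_quot_basis; first exact: tor_boundary_submod.
  by have := hp i; case: i.
- by move=> i; apply: has_kdim_quot_basis; [exact: koszul_boundary_submod|exact: hM].
- by move=> i; apply: has_kdim_quot_basis; [exact: koszul_boundary_submod|exact: hR].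
Qed.
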